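(* Let $\{\alpha_n\}_{n\ge 1}$ be a Blaschke sequence of points in the open unit disk $\mathbb{D}$, with Gram matrix $G$. The sequence $\{\alpha_n\}$ is a thin sequence if and only if $G$ is the identity plus a compact operator on $\ell^2$.
   Context: $\mathbb{D}$ is the open unit disk in $\mathbb{C}$ and $H^2$ is the Hardy space on $\mathbb{D}$. A Blaschke sequence is an (infinite) sequence $\{\alpha_j\}$ in $\mathbb{D}$ with $\sum_j (1-|\alpha_j|)<\infty$. For such a sequence, $B_j$ denotes the Blaschke product with zeros at all the points of the sequence except that the zero $\alpha_j$ is removed, and $\delta_j = |B_j(\alpha_j)| = \prod_{k\ne j}\left|\frac{\alpha_k-\alpha_j}{1-\overline{\alpha_k}\alpha_j}\right|$. The sequence $\{\alpha_j\}$ is thin if $\lim_{j\to\infty}\delta_j = 1$. Let $k_j(z) = \frac{1}{1-\overline{\alpha_j}z}$ be the Szegő kernel (the reproducing kernel of $H^2$ at $\alpha_j$), let $g_j = k_j/\|k_j\|_{H^2}$, and let $G$ be the Gram matrix, the infinite matrix with entries $G_{ij} = \langle g_j, g_i\rangle_{H^2}$, regarded as an operator on $\ell^2$ with respect to the standard orthonormal basis. ''$G$ is the identity plus a compact operator'' means that $G$ defines a bounded operator on $\ell^2$ of the form $I+K$ with $K$ compact. *)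

(* Defs.v *)
From HB Require Import structures.
From mathcomp Require Import all_boot all_order all_algebra complex.
From mathcomp Require Import all_classical all_reals all_analysis.
From mathcomp Require Import ring lra.

Set Implicit Arguments.
Unset Strict Implicit.
Unset Printing Implicit Defensive.
Import Order.TTheory GRing.Theory Num.Theory.
Import numFieldTopology.Exports numFieldNormedType.Exports.
Import ComplexField.
Local Open Scope ring_scope.
Local Open Scope classical_set_scope.

(* mathcomp-analysis puts the norm topology on abstract numFieldTypes only. *)
HB.instance Definition _ (R : realType) :=
  GRing.ComAlgebra.copy R[i] (R[i])^o.
HB.instance Definition _ (R : realType) := Vector.copy R[i] (R[i])^o.
HB.instance Definition _ (R : realType) := NormedModule.copy R[i] (R[i])^o.

(* [`|z|] lives in [R[i]]; [cmod z] is the same modulus as an element of [R]. *)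
Definition cmod (R : realType) (z : R[i]) : R := complex.Re `|z|.

Section ell2.
Context {R : realType}.
Notation C := (R[i]).
Implicit Types (z : C) (a b : nat -> C).

Lemma cmodE z : (cmod z)%:C%C = `|z|.
Proof. by rewrite /cmod normc_def. Qed.

Lemma cmod_ge0 z : 0 <= cmod z.
Proof. by rewrite -ler0c cmodE normr_ge0. Qed.

Lemma cmodM z w : cmod (z * w) = cmod z * cmod w.
Proof. by apply: complexI; rewrite rmorphM !cmodE normrM. Qed.

Lemma cmodJ z : cmod z^* = cmod z.
Proof. by apply: complexI; rewrite !cmodE norm_conjC. Qed.

Lemma cmodD z w : cmod (z + w) <= cmod z + cmod w.
Proof. by rewrite -lecR rmorphD !cmodE ler_normD. Qed.

Lemma cmod0 : cmod (0 : C) = 0.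
Proof. by apply: complexI; rewrite cmodE normr0. Qed.

Lemma cmod1 : cmod (1 : C) = 1.
Proof. by apply: complexI; rewrite cmodE normr1. Qed.

Lemma cmod_eq0 z : cmod z = 0 -> z = 0.
Proof. by move=> z0; apply/normr0_eq0; rewrite -cmodE z0. Qed.

Definition square_summable a : Prop := cvgn (series (fun n => cmod (a n) ^+ 2)).

Definition sqnorm a : R := limn (series (fun n => cmod (a n) ^+ 2)).

Definition dotseq a b : C := limn (series (fun n => a n * (b n)^*)).

Lemma sqnorm_ge0 a : square_summable a -> 0 <= sqnorm a.
Proof.
move=> sa; apply: limr_ge => //; apply: nearW => n.
by rewrite /series/= sumr_ge0 // => i _; rewrite exprn_ge0 ?cmod_ge0.
Qed.

Lemma square_summable0 : square_summable (fun=> 0).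
Proof.
rewrite /square_summable [X in cvgn X](_ : _ = fun=> 0) ?funeqE.
  exact: is_cvg_cst.
by move=> n; rewrite /series/= big1 // => i _; rewrite cmod0 expr0n.
Qed.

Lemma square_summableZ z a :
  square_summable a -> square_summable (fun n => z * a n).
Proof.
move=> sa; rewrite /square_summable.
rewrite [X in series X](_ : _ = cmod z ^+ 2 *: (fun n => cmod (a n) ^+ 2)).
  exact: is_cvg_seriesZ.
by apply/funext => n /=; rewrite cmodM exprMn.
Qed.

Lemma sqnormZ z a :
  square_summable a -> sqnorm (fun n => z * a n) = cmod z ^+ 2 * sqnorm a.
Proof.
move=> sa; rewrite /sqnorm.
rewrite [X in series X](_ : _ = cmod z ^+ 2 *: (fun n => cmod (a n) ^+ 2)).
  by rewrite lim_seriesZ.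
by apply/funext => n /=; rewrite cmodM exprMn.
Qed.

Lemma square_summableD a b : square_summable a -> square_summable b ->
  square_summable (fun n => a n + b n).
Proof.
move=> sa sb.
pose v : R^nat :=
  2 *: (fun n => cmod (a n) ^+ 2) + 2 *: (fun n => cmod (b n) ^+ 2).
apply: (@series_le_cvg _ _ v).
- by move=> n; rewrite exprn_ge0 ?cmod_ge0.
- by move=> n; rewrite addr_ge0// mulr_ge0// exprn_ge0 ?cmod_ge0.
- move=> n; apply: (@le_trans _ _ ((cmod (a n) + cmod (b n)) ^+ 2)).
    by rewrite ler_pXn2r ?nnegrE ?addr_ge0 ?cmod_ge0 ?cmodD.
  rewrite [leRHS](_ : _ = 2 * cmod (a n) ^+ 2 + 2 * cmod (b n) ^+ 2)//.
  rewrite -subr_ge0 [X in _ <= X](_ : _ = (cmod (a n) - cmod (b n)) ^+ 2).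
    by rewrite sqr_ge0.
  by ring.
- by apply: is_cvg_seriesD; exact: is_cvg_seriesZ.
Qed.

Lemma sqnorm_eq0 a : square_summable a -> sqnorm a = 0 -> a = fun=> 0.
Proof.
move=> sa a0; apply/funext => n; apply: cmod_eq0; apply/eqP.
rewrite -sqrf_eq0; apply/eqP/le_anti; rewrite exprn_ge0 ?cmod_ge0// andbT.
rewrite -[leRHS]a0; apply: (@le_trans _ _ (series (fun n => cmod (a n) ^+ 2) n.+1)).
  rewrite /series/= big_nat_recr//= lerDr sumr_ge0// => i _.
  by rewrite exprn_ge0 ?cmod_ge0.
apply: nondecreasing_cvgn_le => //; apply: nondecreasing_series => k _ _.
by rewrite exprn_ge0 ?cmod_ge0.
Qed.

Lemma sqnormD a b : square_summable a -> square_summable b ->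
  Num.sqrt (sqnorm (fun n => a n + b n)) <=
  Num.sqrt (sqnorm a) + Num.sqrt (sqnorm b).
Proof.
move=> sa sb; set A : R := Num.sqrt (sqnorm a); set B : R := Num.sqrt (sqnorm b).
have A0 : 0 <= A by exact: sqrtr_ge0.
have B0 : 0 <= B by exact: sqrtr_ge0.
have AE : A ^+ 2 = sqnorm a by rewrite sqr_sqrtr ?sqnorm_ge0.
have BE : B ^+ 2 = sqnorm b by rewrite sqr_sqrtr ?sqnorm_ge0.
move: A0; rewrite le_eqVlt => /predU1P[A0|A0].
  have -> : (fun n => a n + b n) = b.
    apply/funext => n; rewrite (@sqnorm_eq0 a sa) ?add0r//.
    by rewrite -AE -A0 expr0n.
  by rewrite -A0 add0r.
move: B0; rewrite le_eqVlt => /predU1P[B0|B0].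
  have -> : (fun n => a n + b n) = a.
    apply/funext => n; rewrite (@sqnorm_eq0 b sb) ?addr0//.
    by rewrite -BE -B0 expr0n.
  by rewrite -B0 addr0.
have AB0 : 0 <= A + B by rewrite addr_ge0// ltW.
rewrite -[leRHS]ger0_norm// -sqrtr_sqr; apply: ler_wsqrtr.
pose va : R^nat := (1 + B / A) *: (fun n => cmod (a n) ^+ 2).
pose vb : R^nat := (1 + A / B) *: (fun n => cmod (b n) ^+ 2).
have sva : cvgn (series va) by exact: is_cvg_seriesZ.
have svb : cvgn (series vb) by exact: is_cvg_seriesZ.
have lva : limn (series va) = (1 + B / A) * A ^+ 2.
  by rewrite AE; exact: lim_seriesZ.
have lvb : limn (series vb) = (1 + A / B) * B ^+ 2.
  by rewrite BE; exact: lim_seriesZ.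
have -> : (A + B) ^+ 2 = limn (series (va + vb)).
  by rewrite lim_seriesD// lva lvb; field; rewrite !gt_eqF.
have svab : cvgn (series (va + vb)) by exact: is_cvg_seriesD.
apply: (@lim_series_le R (fun n => cmod (a n + b n) ^+ 2) (va + vb)) => //; [exact: square_summableD|move=> n].
apply: (@le_trans _ _ ((cmod (a n) + cmod (b n)) ^+ 2)).
  by rewrite ler_pXn2r ?nnegrE ?addr_ge0 ?cmod_ge0 ?cmodD.
rewrite [leRHS](_ : _ = (1 + B / A) * cmod (a n) ^+ 2 +
  (1 + A / B) * cmod (b n) ^+ 2)//.
rewrite -subr_ge0 [X in _ <= X](_ : _ =
  (B * cmod (a n) - A * cmod (b n)) ^+ 2 / (A * B)).
  by rewrite divr_ge0 ?sqr_ge0// mulr_ge0// ltW.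
by field; rewrite !gt_eqF.
Qed.

Definition ell2_pred : {pred (nat -> C)} := [pred a | `[< square_summable a >]].

Lemma ell2_submod : submod_closed ell2_pred.
Proof.
split; first exact/asboolT/square_summable0.
move=> z a b /asboolW sa /asboolW sb; apply: asboolT.
exact: (square_summableD (square_summableZ (z := z) sa) sb).
Qed.
HB.instance Definition _ :=
  GRing.isSubmodClosed.Build C (nat -> C) ell2_pred ell2_submod.

Record ell2 := Ell2 { ell2_seq :> nat -> C ; _ : ell2_seq \in ell2_pred }.
HB.instance Definition _ := [isSub for ell2_seq].
HB.instance Definition _ := [Choice of ell2 by <:].
HB.instance Definition _ := [SubChoice_isSubLmodule of ell2 by <:].

Lemma ell2P (x : ell2) : square_summable x.
Proof. exact: asboolW (valP x). Qed.

Definition ell2_norm (x : ell2) : C := (Num.sqrt (sqnorm x))%:C%C.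

Let ell2_normD (x y : ell2) : ell2_norm (x + y) <= ell2_norm x + ell2_norm y.
Proof.
rewrite -rmorphD lecR.
have -> : ell2_seq (x + y) = (fun n => x n + y n) by [].
exact: (sqnormD (@ell2P x) (@ell2P y)).
Qed.

Let ell2_normZ z (x : ell2) : ell2_norm (z *: x) = `|z| * ell2_norm x.
Proof.
rewrite -cmodE -rmorphM; congr (_%:C%C).
have -> : ell2_seq (z *: x) = (fun n => z * x n) by [].
by rewrite (sqnormZ _ (@ell2P x)) sqrtrM ?sqr_ge0// sqrtr_sqr ger0_norm ?cmod_ge0.
Qed.

Let ell2_norm0 (x : ell2) : ell2_norm x = 0 -> x = 0.
Proof.
move=> /(@complexI _ _ 0)/eqP; rewrite sqrtr_eq0 => x0.
apply: val_inj; apply: sqnorm_eq0 (@ell2P x) _.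
by apply/le_anti; rewrite x0 sqnorm_ge0//; exact: ell2P.
Qed.

HB.instance Definition _ :=
  @Lmodule_isNormed.Build C ell2 ell2_norm ell2_normD ell2_normZ ell2_norm0.

Lemma square_summable_delta i : square_summable (fun n => (n == i)%:R).
Proof.
apply/cvg_ex; exists 1; apply: cvg_near_cst; near=> n.
rewrite /series/= (bigD1_seq i) ?iota_uniq ?mem_index_iota//=.
  rewrite eqxx cmod1 expr1n big1 ?addr0// => k /negPf ->.
  by rewrite mulr0n cmod0 expr0n.
by near: n; exact: nbhs_infty_gt.
Unshelve. all: by end_near. Qed.

Lemma ell2_basis_subproof i : (fun n => (n == i)%:R) \in ell2_pred.
Proof. exact/asboolT/square_summable_delta. Qed.

Definition ell2_basis i : ell2 := Ell2 (ell2_basis_subproof i).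

Definition bounded_operator (T : {linear ell2 -> ell2}) : Prop :=
  exists M : R, forall x, `|T x| <= M%:C%C * `|x|.

Definition compact_operator (T : {linear ell2 -> ell2}) : Prop :=
  precompact (T @` [set x | `|x| <= 1]).

(* [M i j] is the inner product of [T e_j] with [e_i]. *)
Definition has_matrix (T : {linear ell2 -> ell2}) (M : nat -> nat -> C) : Prop :=
  forall i j, dotseq (T (ell2_basis j)) (ell2_basis i) = M i j.

Definition identity_plus_compact (M : nat -> nat -> C) : Prop :=
  exists T K : {linear ell2 -> ell2},
    [/\ bounded_operator T, has_matrix T M, compact_operator K
      & forall x, T x = x + K x].

End ell2.
Arguments ell2 : clear implicits.
Arguments ell2P {R} x.

Section hardy.
Context {R : realType}.
Notation C := (R[i]).
Implicit Types (z w c : C) (f g : C -> C) (alpha : nat -> C).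

Definition unit_disc : set C := [set z | cmod z < 1].

Definition taylor f (n : nat) : C := derive1n n f 0 / n`!%:R.

Definition H2 : set (C -> C) :=
  [set f | (forall z, unit_disc z -> derivable f z 1) /\
           square_summable (taylor f)].

(* The coefficient form of the inner product
   lim_(r -> 1-) 1/(2 pi) \int f(r e^it) (g(r e^it))^* dt. *)
Definition H2_dot f g : C := dotseq (taylor f) (taylor g).

Definition H2_norm f : R := Num.sqrt (complex.Re (H2_dot f f)).

Definition szego w : C -> C := fun z => (1 - w^* * z)^-1.

Let is_derive_geom c z (n : nat) : 1 - c * z != 0 ->
  is_derive z (1 : C) (fun y => ((1 - c * y) ^+ n.+1)^-1)
    (n.+1%:R * c / (1 - c * z) ^+ n.+2).
Proof.
move=> cz0.
have d1 : is_derive z (1 : C) (fun y => 1 - c * y) (- c).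
  have -> : (fun y => 1 - c * y) = cst 1 - (c *: id) :> (C -> C) by [].
  by apply: is_derive_eq; rewrite sub0r /GRing.scale/= mulr1.
have d2 : is_derive z (1 : C) ((fun y => 1 - c * y) ^+ n.+1)
  ((n.+1%:R * (1 - c * z) ^+ n) *: (- c)).
  by apply: is_derive_eq.
have e : ((fun y : C => 1 - c * y) ^+ n.+1) = (fun y => (1 - c * y) ^+ n.+1).
  by rewrite exprfctE.
rewrite e in d2.
have nz : (1 - c * z) ^+ n.+1 != 0 by rewrite expf_neq0.
have [dd dE] := d2.
apply: DeriveDef; first exact: derivableV.
rewrite deriveV// dE /GRing.scale/= !exprS.
by field; rewrite cz0 ?expf_neq0.
Qed.

Lemma derive1n_szego w z n : 1 - w^* * z != 0 ->
  derive1n n (szego w) z = n`!%:R * w^* ^+ n / (1 - w^* * z) ^+ n.+1.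
Proof.
elim: n z => [|n ih] z nz; first by rewrite derive1n0 /szego !mul1r.
rewrite derive1nS derive1E.
pose F : C -> C := (n`!%:R * w^* ^+ n) *: (fun y => ((1 - w^* * y) ^+ n.+1)^-1).
rewrite (@near_eq_derive _ _ _ _ F); last first.
  have c : {for z, continuous (fun y : C => 1 - w^* * y)}.
    apply: (@continuousB C C C (cst 1) (fun y : C => w^* * y)).
      exact: (@cst_continuous C C).
    apply: (@continuousM C C (cst w^*) id); last exact: cvg_id.
    exact: (@cst_continuous C C).
  near=> y; rewrite ih//; near: y.
  exact: (@cvgr_neq0 C C C (nbhs z) _ (fun y : C => 1 - w^* * y) _ c nz).
have [dd dE] := @is_derive_geom (w^*) z n nz.
rewrite deriveZ// dE /GRing.scale/= factS natrM [in RHS]exprS; ring.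
Unshelve. all: by end_near. Qed.

Lemma taylor_szego w n : taylor (szego w) n = w^* ^+ n.
Proof.
rewrite /taylor derive1n_szego mulr0 subr0 ?oner_neq0// expr1n divr1.
by rewrite mulrC mulKf// pnatr_eq0 -lt0n fact_gt0.
Qed.

Lemma unit_discM_neq0 w z : unit_disc w -> unit_disc z -> 1 - w^* * z != 0.
Proof.
move=> w1 z1; rewrite subr_eq0; apply/eqP => /(congr1 (@cmod R)).
rewrite cmod1 cmodM cmodJ => /esym wz1.
have : cmod w * cmod z < 1 by rewrite mulr_ilt1 ?cmod_ge0.
by rewrite wz1 ltxx.
Qed.

Lemma szego_H2 w : unit_disc w -> H2 (szego w).
Proof.
move=> w1; split => [z z1|].
  have [d _] := @is_derive_geom w^* z 0 (unit_discM_neq0 w1 z1).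
  exact: d.
rewrite /square_summable.
rewrite [X in series X](_ : _ = geometric 1 (cmod w ^+ 2)).
  apply: is_cvg_geometric_series.
  by rewrite ger0_norm ?exprn_ge0 ?cmod_ge0// expr_lt1// ?cmod_ge0.
apply/funext => n; rewrite taylor_szego/= mul1r -exprM mulnC exprM.
congr (_ ^+ 2); apply: complexI.
by rewrite cmodE normrX rmorphXn/= norm_conjC cmodE.
Qed.

Lemma cvg_geometricC z : unit_disc z ->
  series (fun n => z ^+ n) @ \oo --> (1 - z)^-1.
Proof.
move=> z1; have z1' : 1 - z != 0.
  rewrite subr_eq0; apply: contraTneq z1 => <-.
  by rewrite /unit_disc/= cmod1 ltxx.
have -> : series (fun n => z ^+ n) = (fun n => (1 - z ^+ n) / (1 - z)).
  apply/funext => n; apply: (canRL (mulfK z1')).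
  rewrite /series/= big_mkord mulrC -[in RHS](expr1n _ n) subrXX; congr (_ * _).
  by apply: eq_bigr => k _; rewrite expr1n mul1r.
suff : (fun n => (1 - z ^+ n) / (1 - z)) @ \oo --> (1 - 0) / (1 - z).
  by rewrite subr0 mul1r.
apply: (@cvgM C nat \oo _ (fun n => 1 - z ^+ n) (fun=> (1 - z)^-1)).
  apply: (@cvgB C C nat \oo _ (fun=> 1) (fun n => z ^+ n)).
    exact: cvg_cst.
  apply/(@cvgr0Pnorm_lt C C) => e e0.
  have eE : e = (cmod e)%:C%C by rewrite cmodE gtr0_norm.
  have := @cvg_geometric R 1 (cmod z).
  rewrite ger0_norm ?cmod_ge0// => /(_ z1) /cvgr0Pnorm_lt/(_ (cmod e)).
  rewrite -ltcR -eE => /(_ e0); apply: filterS => n /=.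
  rewrite mul1r ger0_norm ?exprn_ge0 ?cmod_ge0// -ltcR -eE.
  by rewrite rmorphXn/= cmodE normrX.
exact: cvg_cst.
Qed.

Lemma H2_dot_szego w z : unit_disc w -> unit_disc z ->
  H2_dot (szego w) (szego z) = szego w z.
Proof.
move=> w1 z1; rewrite /H2_dot /dotseq.
rewrite [X in series X](_ : _ = (fun n => (w^* * z) ^+ n)).
  apply: (@cvg_lim C) => //; apply: cvg_geometricC.
  by rewrite /unit_disc/= cmodM cmodJ mulr_ilt1 ?cmod_ge0.
by apply/funext => n; rewrite !taylor_szego rmorphXn/= conjCK exprMn.
Qed.

Definition nszego w : C -> C := fun z => szego w z / (H2_norm (szego w))%:C%C.

Definition gram alpha (i j : nat) : C :=
  H2_dot (nszego (alpha j)) (nszego (alpha i)).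

Definition blaschke_sequence alpha : Prop :=
  (forall j, unit_disc (alpha j)) /\
  cvgn (series (fun j => 1 - cmod (alpha j))).

Definition blaschke_delta alpha (j : nat) : R :=
  limn (fun n => \prod_(k < n | k != j :> nat)
    cmod ((alpha k - alpha j) / (1 - (alpha k)^* * alpha j))).

Definition thin alpha : Prop := blaschke_delta alpha @ \oo --> (1 : R).

End hardy.

(* Main.v *)
From HB Require Import structures.
Require Import Defs.
From mathcomp Require Import all_boot all_order all_algebra complex.
From mathcomp Require Import all_classical all_reals all_analysis.
From mathcomp Require Import ring lra.

Set Implicit Arguments.
Unset Strict Implicit.
Unset Printing Implicit Defensive.
Import Order.TTheory GRing.Theory Num.Theory.
Import numFieldTopology.Exports numFieldNormedType.Exports.
Import ComplexField.
Local Open Scope ring_scope.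
Local Open Scope classical_set_scope.

(** Throughout, [h_i = 1 - |alpha_i|^2], and the Gram entries are the normalized
    kernels [G_ij = sqrt (h_i h_j) / (1 - conj alpha_j * alpha_i)], whose squared
    moduli [|G_ij|^2 = 1 - rho_ij^2] measure how far the pseudohyperbolic distance
    [rho_ij] is from 1.

    If [G = I + K] with [K] compact, then [K e_j] tends to 0 in norm: it stays in
    a compact set and each of its coordinates tends to 0, because
    [sum h_i < oo]. But [|K e_j|^2 = sum_(k <> j) (1 - rho_kj^2)], and
    [delta_j^2 = prod_(k <> j) rho_kj^2 >= 1 - sum_(k <> j) (1 - rho_kj^2)], so
    [delta_j] tends to 1 ([identity_plus_compact_thin]).

    Conversely, thinness makes the sums [sum_(k <> j) |G_kj|^2] small for large
    [j], so the columns of [G - I] are small; what has to be shown is that the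
    norm of a tail section of [G - I] is small, uniformly in its size
    ([gram_form_near_identity]). Summing absolute values does not suffice, because
    the matrix [|G_ij|] may be unbounded. Three facts about the quadratic form [Q]
    of a finite section are combined.

    - The real part of the kernel [1 / (1 - u)] is [1/2 + (1 - |u|^2) / (2 |1 - u|^2)],
      a positive Poisson kernel. Off the diagonal, the corresponding matrix is
      dominated by [N + N^T] plus a small rank one matrix, where [N N^T] is dominated
      entrywise by a small multiple of [I + N + N^T]; so [N] has small norm
      ([positive_kernel_bound]). This gives
      [Q(c) + Q(conj c) <= 2 (1 + eta) |c|^2] with small [eta].

    - Orthonormalizing the kernels in the given order and in the reverse order
      gives two Takenaka-Malmquist expansions of [Q] as a sum of squares. Pairing
      one with the other yields
      [|sum_i beta_i c_i e_i|^2 <= Q(c) Q(e)], where [beta_i] is the product of the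
      Blaschke factors of the other points at the [i]-th one ([pairing_le]). As
      [|beta_i|] is close to 1, an upper bound [Q <= L] forces a lower bound
      [Q >= (1 - eps) / L].

    - Together these say that every upper bound [L] of [Q] on unit vectors
      improves to [2 (1 + eta) - (1 - eps) / L]; the least upper bound therefore
      satisfies [L^2 - 2 (1 + eta) L + 1 - eps <= 0], which places it near 1, and
      then the lower bound is near 1 as well.

    A matrix with square-summable rows and columns whose tail sections have small
    norm defines a compact operator ([compact_matrix_operator]), because it maps
    the unit ball to a bounded set with uniformly small tails. *)

(** * Finite sums and complex moduli *)

(** Taking one of the two families constant equal to 1 covers the sums of squares
    of both Takenaka-Malmquist expansions; two different points give their pairing. *)
Lemma telescope_prod (K : comNzRingType) (x y : nat -> K) m :
  \sum_(k < m) (\prod_(i < k) x i) * (x k - y k) * (\prod_(k.+1 <= i < m) y i) =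
  \prod_(i < m) x i - \prod_(i < m) y i.
Proof.
elim: m => [|m IH]; first by rewrite !big_ord0 subrr.
rewrite big_ord_recr /= big_geq // mulr1.
under eq_bigr => k _ do rewrite (big_nat_recr m) ?ltn_ord //= mulrA.
rewrite -mulr_suml IH !big_ord_recr /=; ring.
Qed.

Lemma weierstrass_prod (R : realDomainType) (I : finType) (P : pred I) (u : I -> R) :
  (forall i, 0 <= u i <= 1) ->
  1 - \sum_(i | P i) u i <= \prod_(i | P i) (1 - u i).
Proof.
move=> u01; suff : [&& 0 <= \sum_(i | P i) u i, 0 <= \prod_(i | P i) (1 - u i) &
    1 - \sum_(i | P i) u i <= \prod_(i | P i) (1 - u i)] by case/and3P.
elim/big_rec2: _ => [|i p s _ /and3P[s0 p0 le]]; first by rewrite subr0 !lexx ler01.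
have /andP[u0 u1] := u01 i.
rewrite addr_ge0 //= mulr_ge0 ?subr_ge0 //=; nra.
Qed.

(** Cleared form of [prod (1 - u) <= prod (1 / (1 + u)) <= 1 / (1 + sum u)]. *)
Lemma prod_sum_le1 (R : realDomainType) (I : finType) (P : pred I) (u : I -> R) :
  (forall i, 0 <= u i <= 1) ->
  (\prod_(i | P i) (1 - u i)) * (1 + \sum_(i | P i) u i) <= 1.
Proof.
move=> u01; suff : [&& 0 <= \sum_(i | P i) u i, 0 <= \prod_(i | P i) (1 - u i) &
    (\prod_(i | P i) (1 - u i)) * (1 + \sum_(i | P i) u i) <= 1] by case/and3P.
elim/big_rec2: _ => [|i p s _ /and3P[s0 p0 le]].
  by rewrite addr0 mulr1 !lexx ler01.
have /andP[u0 u1] := u01 i.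
rewrite addr_ge0 //= mulr_ge0 ?subr_ge0 //=.
have : 0 <= p * s * u i by rewrite !mulr_ge0.
have : 0 <= p * u i ^+ 2 by rewrite mulr_ge0 ?sqr_ge0.
by nra.
Qed.

Section modulus.
Context {R : realType}.
Notation C := (R[i]).
Implicit Types z w : C.

Lemma cmod_sqrC z : (cmod z ^+ 2)%:C%C = z * z^*.
Proof. by rewrite rmorphXn /= cmodE normCK. Qed.

Lemma cmod_sqr z : cmod z ^+ 2 = complex.Re z ^+ 2 + complex.Im z ^+ 2.
Proof. by apply: complexI; rewrite add_Re2_Im2 rmorphXn /= cmodE. Qed.

Lemma cmodR (x : R) : cmod x%:C%C = `|x|.
Proof. by rewrite /cmod normc_def /= expr0n addr0 sqrtr_sqr. Qed.

Lemma cmodN z : cmod (- z) = cmod z.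
Proof. by apply: complexI; rewrite !cmodE normrN. Qed.

Lemma cmodV z : cmod z^-1 = (cmod z)^-1.
Proof. by apply: complexI; rewrite fmorphV /= !cmodE normfV. Qed.

Lemma cmod_gt0 z : z != 0 -> 0 < cmod z.
Proof. by move=> z0; rewrite -ltcR cmodE normr_gt0. Qed.

Lemma ReD z w : complex.Re (z + w) = complex.Re z + complex.Re w.
Proof. by case: z w => [a b] [c d]. Qed.

Lemma ImD z w : complex.Im (z + w) = complex.Im z + complex.Im w.
Proof. by case: z w => [a b] [c d]. Qed.

Lemma ReJ z : complex.Re z^* = complex.Re z.
Proof. by case: z. Qed.

Lemma ReN z : complex.Re (- z) = - complex.Re z.
Proof. by case: z. Qed.

Lemma ReZ (x : R) z : complex.Re (x%:C%C * z) = x * complex.Re z.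
Proof. by case: z => a b /=; rewrite mul0r subr0. Qed.

Lemma Re_sum (I : Type) (r : seq I) (P : pred I) (F : I -> C) :
  complex.Re (\sum_(i <- r | P i) F i) = \sum_(i <- r | P i) complex.Re (F i).
Proof. exact: (big_morph (@complex.Re R) ReD). Qed.

Lemma Im_sum (I : Type) (r : seq I) (P : pred I) (F : I -> C) :
  complex.Im (\sum_(i <- r | P i) F i) = \sum_(i <- r | P i) complex.Im (F i).
Proof. exact: (big_morph (@complex.Im R) ImD). Qed.

Lemma Re_le_cmod z : `|complex.Re z| <= cmod z.
Proof.
rewrite -(@ler_pXn2r _ 2) ?nnegrE ?cmod_ge0 // real_normK ?num_real //.
by rewrite cmod_sqr lerDl sqr_ge0.
Qed.

Lemma Im_le_cmod z : `|complex.Im z| <= cmod z.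
Proof.
rewrite -(@ler_pXn2r _ 2) ?nnegrE ?cmod_ge0 // real_normK ?num_real //.
by rewrite cmod_sqr lerDr sqr_ge0.
Qed.

Lemma cmod_sum (I : Type) (r : seq I) (P : pred I) (F : I -> C) :
  cmod (\sum_(i <- r | P i) F i) <= \sum_(i <- r | P i) cmod (F i).
Proof.
elim/big_rec2: _ => [|i x y _ le]; first by rewrite cmod0.
by apply: le_trans (cmodD _ _) _; rewrite lerD2l.
Qed.

Lemma cmod_prod (I : Type) (r : seq I) (P : pred I) (F : I -> C) :
  cmod (\prod_(i <- r | P i) F i) = \prod_(i <- r | P i) cmod (F i).
Proof. exact: (big_morph (@cmod R) (@cmodM R) (@cmod1 R)). Qed.

(** Lagrange's identity makes the defect a sum of squares. *)
Lemma cauchy_schwarz (I : finType) (P : pred I) (u v : I -> R) :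
  (\sum_(i | P i) u i * v i) ^+ 2 <=
  (\sum_(i | P i) u i ^+ 2) * (\sum_(i | P i) v i ^+ 2).
Proof.
rewrite -subr_ge0 -(pmulr_rge0 _ (ltr0n R 2)).
suff -> : 2%:R * ((\sum_(i | P i) u i ^+ 2) * (\sum_(i | P i) v i ^+ 2) -
    (\sum_(i | P i) u i * v i) ^+ 2) =
    \sum_(i | P i) \sum_(j | P j) (u i * v j - u j * v i) ^+ 2.
  by apply: sumr_ge0 => i _; apply: sumr_ge0 => j _; exact: sqr_ge0.
set A := \sum_(i | P i) u i ^+ 2; set B := \sum_(i | P i) v i ^+ 2.
set S := \sum_(i | P i) u i * v i.
have -> : 2%:R * (A * B - S ^+ 2) = A * B + B * A - 2%:R * (S * S) by ring.
rewrite !big_distrlr /= mulr_sumr -big_split /= -sumrB.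
apply: eq_bigr => i _; rewrite mulr_sumr -big_split /= -sumrB.
by apply: eq_bigr => j _; ring.
Qed.

Lemma cauchy_schwarz_cmod (I : finType) (P : pred I) (u v : I -> C) :
  cmod (\sum_(i | P i) u i * v i) ^+ 2 <=
  (\sum_(i | P i) cmod (u i) ^+ 2) * (\sum_(i | P i) cmod (v i) ^+ 2).
Proof.
apply: le_trans (cauchy_schwarz _ _ _).
rewrite ler_pXn2r ?nnegrE ?cmod_ge0 //; last first.
  by apply: sumr_ge0 => i _; rewrite mulr_ge0 ?cmod_ge0.
by apply: le_trans (cmod_sum _ _ _) _; under eq_bigr do rewrite cmodM.
Qed.

Lemma cmodD_sqr z w : cmod (z + w) ^+ 2 <= 2 * cmod z ^+ 2 + 2 * cmod w ^+ 2.
Proof.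
apply: (@le_trans _ _ ((cmod z + cmod w) ^+ 2)).
  by rewrite ler_pXn2r ?nnegrE ?addr_ge0 ?cmod_ge0 ?cmodD.
by have := sqr_ge0 (cmod z - cmod w); lra.
Qed.

End modulus.

(** * The normalized Szegő kernel and the Takenaka-Malmquist expansions *)

Section kernel.
Context {R : realType}.
Notation C := (R[i]).
Implicit Types (z w a : C) (c e : nat -> C).

Definition szego_weight w : R := Num.sqrt (1 - cmod w ^+ 2).

Definition nkernel z w : C :=
  (szego_weight z * szego_weight w)%:C%C / (1 - w^* * z).

Definition blaschke_factor a z : C := (z - a) / (1 - a^* * z).

Lemma disc_weight_gt0 w : unit_disc w -> 0 < 1 - cmod w ^+ 2.
Proof. by move=> w1; rewrite subr_gt0 expr_lt1 // cmod_ge0. Qed.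

Lemma szego_weight_gt0 w : unit_disc w -> 0 < szego_weight w.
Proof. by move=> w1; rewrite sqrtr_gt0 disc_weight_gt0. Qed.

Lemma szego_weight_sqr w : unit_disc w -> szego_weight w ^+ 2 = 1 - cmod w ^+ 2.
Proof. by move=> w1; rewrite sqr_sqrtr // ltW // disc_weight_gt0. Qed.

Lemma szego_weight_sqrC w :
  unit_disc w -> (szego_weight w)%:C%C ^+ 2 = 1 - w * w^* :> C.
Proof.
by move=> w1; rewrite -rmorphXn /= szego_weight_sqr // rmorphB rmorph1 /= cmod_sqrC.
Qed.

Lemma conj_real_complex (x : R) : (x%:C%C)^* = x%:C%C :> C.
Proof. by apply/CrealP/complex_realP; exists x. Qed.

Lemma nkernelJ z w : (nkernel z w)^* = nkernel w z.
Proof.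
rewrite /nkernel [LHS]rmorphM fmorphV rmorphB rmorph1.
rewrite [X in _ / (1 - X)]rmorphM /= conjCK conj_real_complex.
by rewrite (mulrC (szego_weight z)) (mulrC w).
Qed.

Lemma blaschke_factor_id a : blaschke_factor a a = 0.
Proof. by rewrite /blaschke_factor subrr mul0r. Qed.

Lemma nkernel_id z : unit_disc z -> nkernel z z = 1.
Proof.
move=> z1; rewrite /nkernel -expr2 rmorphXn /= szego_weight_sqrC //.
by rewrite [z * _]mulrC mulfV // unit_discM_neq0.
Qed.

(** Reproducing kernel identity for dividing out one Blaschke factor: subtracting
    the projection on the kernel at [a] multiplies the kernel by the factors of
    [a] at both points. *)
Lemma nkernelMJ z w a : unit_disc z -> unit_disc w -> unit_disc a ->
  nkernel z a * (nkernel w a)^* =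
  nkernel z w * (1 - blaschke_factor a z * (blaschke_factor a w)^*).
Proof.
move=> z1 w1 a1; rewrite nkernelJ /nkernel /blaschke_factor.
have -> : ((w - a) / (1 - a^* * w))^* = (w^* - a^*) / (1 - w^* * a) :> C.
  by rewrite [LHS]rmorphM fmorphV !rmorphB rmorph1 [X in _ / (1 - X)]rmorphM /= conjCK (mulrC a).
have A := unit_discM_neq0 a1 z1; have B := unit_discM_neq0 w1 a1.
have D := unit_discM_neq0 w1 z1.
have E := szego_weight_sqrC a1.
rewrite !rmorphM /=; move: E A B D.
set rz : C := (szego_weight z)%:C%C; set rw : C := (szego_weight w)%:C%C.
set ra : C := (szego_weight a)%:C%C.
move=> E A B D.
have -> : rz * ra / (1 - a^* * z) * (ra * rw / (1 - w^* * a)) =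
  ra ^+ 2 * (rz * rw / ((1 - a^* * z) * (1 - w^* * a))) by field; rewrite A B.
by rewrite E; field; rewrite A B D.
Qed.

(** Holomorphic counterpart of [nkernelMJ]: a divided difference of a Blaschke
    factor. *)
Lemma nkernelM z w a : unit_disc z -> unit_disc w -> unit_disc a ->
  (z - w) * (nkernel z a * nkernel w a) =
  (szego_weight z * szego_weight w)%:C%C *
  (blaschke_factor a z - blaschke_factor a w).
Proof.
move=> z1 w1 a1; rewrite /nkernel /blaschke_factor.
have A := unit_discM_neq0 a1 z1; have B := unit_discM_neq0 a1 w1.
have E := szego_weight_sqrC a1.
rewrite !rmorphM /=; move: E A B.
set rz : C := (szego_weight z)%:C%C; set rw : C := (szego_weight w)%:C%C.
set ra : C := (szego_weight a)%:C%C.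
move=> E A B.
have -> : (z - w) * (rz * ra / (1 - a^* * z) * (rw * ra / (1 - a^* * w))) =
  ra ^+ 2 * ((z - w) * rz * rw / ((1 - a^* * z) * (1 - a^* * w))).
  by field; rewrite A B.
by rewrite E; field; rewrite A B.
Qed.

Lemma nkernel_sqr z w : unit_disc z -> unit_disc w ->
  cmod (nkernel z w) ^+ 2 = 1 - cmod (blaschke_factor w z) ^+ 2.
Proof.
move=> z1 w1; apply: complexI; rewrite cmod_sqrC nkernelMJ // nkernel_id //.
by rewrite mul1r rmorphB rmorph1 /= cmod_sqrC.
Qed.

Lemma cmod_nkernel z w : unit_disc z -> unit_disc w ->
  cmod (nkernel z w) = szego_weight z * szego_weight w / cmod (1 - w^* * z).
Proof.
move=> z1 w1; rewrite /nkernel cmodM cmodR cmodV ger0_norm //.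
by rewrite mulr_ge0 ?sqrtr_ge0.
Qed.

Section finite.
Variables (a : nat -> C) (m : nat).
Hypothesis a1 : forall i, unit_disc (a i).

Definition gram_form c : C :=
  \sum_(i < m) \sum_(j < m) c i * (c j)^* * nkernel (a i) (a j).

(** With [W k] the Blaschke product over the points before, or after, the [k]-th
    one, these are the conjugates of the coordinates of [sum_i (conj c_i) g_i] in a
    Takenaka-Malmquist basis of the span of the normalized kernels [g_i]. *)
Definition kernel_coef (W : nat -> C -> C) c (k : nat) : C :=
  \sum_(i < m) W k (a i) * c i * nkernel (a i) (a k).

(** Parseval's identity for a Takenaka-Malmquist basis: by [nkernelMJ] it reduces
    to a telescoping sum. *)
Lemma sum_kernel_coef (W : nat -> C -> C) c :
  (forall i j : 'I_m, \sum_(k < m) W k (a i) * (W k (a j))^* *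
     (1 - blaschke_factor (a k) (a i) * (blaschke_factor (a k) (a j))^*) = 1) ->
  (\sum_(k < m) cmod (kernel_coef W c k) ^+ 2)%:C%C = gram_form c.
Proof.
move=> W1; rewrite rmorph_sum /=.
under eq_bigr => k _.
  rewrite cmod_sqrC /kernel_coef rmorph_sum /= big_distrlr /=.
  over.
rewrite exchange_big; apply: eq_bigr => i _ /=.
rewrite exchange_big; apply: eq_bigr => j _ /=.
rewrite -[RHS]mulr1 -(W1 i j) mulr_sumr; apply: eq_bigr => k _.
rewrite [X in _ * X = _]rmorphM /= [X in _ * (X * _) = _]rmorphM /=.
transitivity (W k (a i) * (W k (a j))^* * (c i * (c j)^*) *
  (nkernel (a i) (a k) * (nkernel (a j) (a k))^*)); first by ring.
by rewrite nkernelMJ //; ring.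
Qed.

Definition blaschke_before k z := \prod_(i < k) blaschke_factor (a i) z.

Definition blaschke_after k z := \prod_(k.+1 <= i < m) blaschke_factor (a i) z.

Lemma prod_eq0_at (F : nat -> C) (i : 'I_m) : F i = 0 -> \prod_(k < m) F k = 0.
Proof. by move=> F0; rewrite (bigD1 i) //= F0 mul0r. Qed.

(** The telescoping sum equals 1 minus a Blaschke product that vanishes at all the
    points. *)
Lemma sum_before c :
  (\sum_(k < m) cmod (kernel_coef blaschke_before c k) ^+ 2)%:C%C = gram_form c.
Proof.
apply: sum_kernel_coef => i j.
pose F k := blaschke_factor (a k) (a i) * (blaschke_factor (a k) (a j))^*.
have F0 : F i = 0 by rewrite /F blaschke_factor_id mul0r.
have := telescope_prod F (fun=> 1) m; rewrite (prod_eq0_at F0).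
rewrite [X in _ = 0 - X]big1 // sub0r => /(congr1 -%R); rewrite opprK => tel.
rewrite -[RHS]tel -sumrN; apply: eq_bigr => k _.
rewrite [X in _ = - (_ * X)]big1 // mulr1.
by rewrite -[RHS]mulrN opprB /blaschke_before rmorph_prod -big_split.
Qed.

Lemma sum_after c :
  (\sum_(k < m) cmod (kernel_coef blaschke_after c k) ^+ 2)%:C%C = gram_form c.
Proof.
apply: sum_kernel_coef => i j.
pose F k := blaschke_factor (a k) (a i) * (blaschke_factor (a k) (a j))^*.
have F0 : F i = 0 by rewrite /F blaschke_factor_id mul0r.
have := telescope_prod (fun=> 1) F m; rewrite (prod_eq0_at F0).
rewrite [X in _ = X - 0]big1 // subr0 => tel.
rewrite -[RHS]tel; apply: eq_bigr => k _; rewrite [X in _ = X * _ * _]big1 // mul1r mulrC.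
by rewrite /blaschke_after rmorph_prod -big_split.
Qed.

Definition punctured_product (i : nat) : C :=
  \prod_(l < m | l != i :> nat) blaschke_factor (a l) (a i).

Hypothesis a_inj : forall i j, (i < m)%N -> (j < m)%N -> a i = a j -> i = j.

(** By [nkernelM], the coefficient of [c_i e_j] is the divided difference of the
    full Blaschke product between two of its zeros, hence 0 when the points
    differ. When [i = j], every term with [k <> i] contains the factor of the
    [i]-th point, which vanishes there, and the term [k = i] omits it. *)
Lemma pairing_kernel_coef c e :
  \sum_(k < m) kernel_coef blaschke_before c k * kernel_coef blaschke_after e k
  = \sum_(i < m) punctured_product i * c i * e i.
Proof.
under eq_bigr => k _ do rewrite /kernel_coef big_distrlr /=.
rewrite exchange_big; apply: eq_bigr => i _ /=.
rewrite exchange_big /= (bigD1 i) //= [X in _ + X]big1 ?addr0; last first.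
  move=> j ji; rewrite (eq_bigr (fun k : 'I_m => c i * e j *
    (blaschke_before k (a i) * blaschke_after k (a j) *
     (nkernel (a i) (a k) * nkernel (a j) (a k))))); last by move=> k _; ring.
  rewrite -mulr_sumr; apply/eqP; rewrite mulf_eq0; apply/orP; right.
  have aij : a i - a j != 0.
    rewrite subr_eq0; apply: contra ji => /eqP aij.
    by apply/eqP/val_inj; apply: a_inj; rewrite ?ltn_ord.
  rewrite -(mulrI_eq0 _ (mulfI aij)) mulr_sumr.
  pose F (j : 'I_m) k := blaschke_factor (a k) (a j).
  have F0 l : F l l = 0 by exact: blaschke_factor_id.
  have := telescope_prod (F i) (F j) m.
  rewrite !(prod_eq0_at (F0 _)) subrr => tel.
  rewrite (eq_bigr (fun k : 'I_m =>
    (szego_weight (a i) * szego_weight (a j))%:C%C *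
    (blaschke_before k (a i) *
      (blaschke_factor (a k) (a i) - blaschke_factor (a k) (a j)) *
      blaschke_after k (a j)))).
    by rewrite -mulr_sumr /blaschke_before /blaschke_after tel mulr0.
  move=> k _; rewrite mulrCA nkernelM //; ring.
rewrite (bigD1 i) //= nkernel_id // !mulr1 [X in _ + X]big1 ?addr0; last first.
  move=> k ki; have : (k < i)%N || (i < k)%N by rewrite -neq_ltn.
  case/orP => lt.
    rewrite [blaschke_after k _](_ : _ = 0) ?mul0r ?mulr0 //.
    rewrite /blaschke_after (bigD1_seq (i : nat)) ?iota_uniq //=.
      by rewrite blaschke_factor_id mul0r.
    by rewrite mem_index_iota lt ltn_ord.
  rewrite [blaschke_before k _](_ : _ = 0) ?mul0r //.
  by rewrite /blaschke_before (bigD1 (Ordinal lt)) //= blaschke_factor_id mul0r.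
rewrite [LHS](_ : _ = blaschke_before i (a i) * blaschke_after i (a i) *
  (c i * e i)); last by ring.
rewrite -[RHS]mulrA; congr (_ * _).
rewrite /blaschke_before /blaschke_after /punctured_product.
rewrite -(big_mkord (fun l => l != i) (fun l => blaschke_factor (a l) (a i))).
rewrite [RHS](@big_cat_nat _ _ _ i) //= ?(ltnW (ltn_ord i)) //.
have [im mi] := (ltn_ord i, ltnW (ltn_ord i)).
congr (_ * _).
  rewrite -(big_mkord xpredT (fun l => blaschke_factor (a l) (a i))).
  rewrite big_nat_cond [RHS]big_nat_cond; apply: eq_bigl => l.
  by rewrite andbT; case: (ltngtP l i); rewrite ?andbF ?andbT.
rewrite [RHS]big_ltn_cond // eqxx /=.
rewrite big_nat_cond [RHS]big_nat_cond; apply: eq_bigl => l.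
by rewrite andbT; case: (ltngtP l i); rewrite ?andbF ?andbT.
Qed.

Lemma gram_form_ge0 c : 0 <= complex.Re (gram_form c).
Proof. by rewrite -sum_before; apply: sumr_ge0 => k _; exact: sqr_ge0. Qed.

(** The underlying fact is that the inverse of the Gram matrix [G] has the form
    [D G^T D^H] with [D] diagonal and [|D_ii| = 1 / |beta_i|], where [beta_i] is the
    punctured product at the [i]-th point; the two expansions give this bound
    without an inversion. *)
Lemma pairing_le c e :
  cmod (\sum_(i < m) punctured_product i * c i * e i) ^+ 2 <=
  complex.Re (gram_form c) * complex.Re (gram_form e).
Proof.
rewrite -pairing_kernel_coef -sum_before -[gram_form e]sum_after.
exact: cauchy_schwarz_cmod.
Qed.

End finite.
End kernel.

(** * A positive matrix estimate *)

(** Let [N i j = r_i^3 r_j / D_ij] for [i <> j]. From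
    [D_im <= 2 (D_ij + D_jm)] one gets
    [1 / (D_ij D_jm) <= 2 / D_im * (1 / D_ij + 1 / D_jm)], and summation over [j]
    bounds the entries of [N N^T] by those of [2 eps (N + N^T)], with 1 in place
    of the diagonal of [N]. Hence, for [x >= 0], [|N^T x|^2 <= 4 eps (t + S)]; now
    apply the Cauchy-Schwarz inequality to [S = <x, N^T x>]. Schur's
    test on [N] with the weights [r_i] would fail: its column sums grow with the
    number of points that lie above a given one. *)
Lemma positive_kernel_bound (R : realType) (I : finType) (r : I -> R)
    (D : I -> I -> R) (eps : R) (x : I -> R) (t S : R) :
  (forall i, 0 < r i) -> (forall i j, 0 < D i j) ->
  (forall i j, D i j = D j i) -> (forall i, D i i = r i ^+ 4) ->
  (forall i j m, D i m <= 2 * (D i j + D j m)) ->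
  (forall i, \sum_(j | j != i) r i ^+ 2 * r j ^+ 2 / D i j <= eps) ->
  (forall i, 0 <= x i) ->
  t = \sum_i x i ^+ 2 ->
  S = \sum_i \sum_(j | j != i) r i ^+ 3 * r j / D i j * (x i * x j) ->
  S ^+ 2 <= 4 * eps * t * (t + S).
Proof.
move=> r0 D0 Dsym Ddiag Dtri Deps x0 tE SE.
pose N i j := r i ^+ 3 * r j / D i j.
have N0 i j : 0 <= N i j by rewrite divr_ge0 ?mulr_ge0 ?exprn_ge0 // ltW.
pose y j := \sum_(i | i != j) N i j * x i.
have SyE : S = \sum_j x j * y j.
  rewrite SE (exchange_big_dep predT) //=; apply: eq_bigr => j _.
  rewrite mulr_sumr; apply: eq_big => [i|i _]; first by rewrite eq_sym.
  by rewrite /N; ring.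
have t0 : 0 <= t by rewrite tE; apply: sumr_ge0 => i _; exact: sqr_ge0.
apply: (@le_trans _ _ (t * \sum_j y j ^+ 2)).
  by rewrite SyE tE; exact: cauchy_schwarz.
suff le_y : \sum_j y j ^+ 2 <= 4 * eps * (t + S).
  rewrite [leRHS](_ : _ = t * (4 * eps * (t + S))); last by ring.
  exact: ler_wpM2l.
have pointwise i m : \sum_(j | (j != i) && (j != m)) N i j * N m j <=
    2 * eps * (N i m + N m i).
  apply: (@le_trans _ _ (\sum_(j | (j != i) && (j != m))
     (2 * N m i * (r i ^+ 2 * r j ^+ 2 / D i j) +
      2 * N i m * (r m ^+ 2 * r j ^+ 2 / D m j)))).
    apply: ler_sum => j _; rewrite /N.
    rewrite -subr_ge0 (Dsym m i).
    have -> : 2 * (r m ^+ 3 * r i / D i m) * (r i ^+ 2 * r j ^+ 2 / D i j) +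
      2 * (r i ^+ 3 * r m / D i m) * (r m ^+ 2 * r j ^+ 2 / D m j) -
      r i ^+ 3 * r j / D i j * (r m ^+ 3 * r j / D m j) =
      r i ^+ 3 * r m ^+ 3 * r j ^+ 2 * (2 * (D i j + D j m) - D i m) /
      (D i m * D i j * D m j).
      by rewrite (Dsym j m); field; rewrite !gt_eqF.
    rewrite divr_ge0 ?mulr_ge0 ?exprn_ge0 ?subr_ge0 //; by rewrite ltW.
  rewrite big_split /= -!mulr_sumr.
  have le1 (A : pred I) k : (forall j, A j -> j != k) ->
      \sum_(j | A j) r k ^+ 2 * r j ^+ 2 / D k j <= eps.
    move=> Ak; apply: le_trans (Deps k).
    rewrite big_mkcond [leRHS]big_mkcond /=; apply: ler_sum => j _.
    case: ifPn => [/Ak -> //|_]; case: ifP => // _.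
    by rewrite divr_ge0 ?mulr_ge0 ?sqr_ge0 // ltW.
  have := le1 (fun j => (j != i) && (j != m)) i (fun j => @proj1 _ _ \o andP).
  have := le1 (fun j => (j != i) && (j != m)) m (fun j => @proj2 _ _ \o andP).
  set P := \sum_(j | _) _; set Q := \sum_(j | _) _ => Pe Qe.
  apply: (@le_trans _ _ (2 * N m i * eps + 2 * N i m * eps)); last lra.
  by apply: lerD; apply: ler_wpM2l => //; rewrite mulr_ge0.
have -> : \sum_j y j ^+ 2 = \sum_i \sum_m x i * x m *
    \sum_(j | (j != i) && (j != m)) N i j * N m j.
  under eq_bigr => j _.
    rewrite expr2 /y big_distrlr /= big_mkcond /=.
    under eq_bigr => i _ do rewrite big_mkcond /=.
    over.
  rewrite exchange_big; apply: eq_bigr => i _ /=.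
  under [RHS]eq_bigr => m _ do rewrite mulr_sumr big_mkcond /=.
  rewrite [RHS]exchange_big; apply: eq_bigr => j _ /=.
  rewrite eq_sym; case: ifP => _ /=; last by rewrite big1.
  by apply: eq_bigr => m _; rewrite eq_sym; case: ifP => // _; ring.
have -> : 4 * eps * (t + S) = \sum_i \sum_m x i * x m *
    (2 * eps * (N i m + N m i)).
  have full : \sum_i \sum_m x i * x m * N i m = t + S.
    rewrite tE SE -big_split /=; apply: eq_bigr => i _.
    rewrite (bigD1 i) //= [N i i](_ : _ = 1); last first.
      by rewrite /N Ddiag -exprSr divff // expf_neq0 // gt_eqF.
    by rewrite mulr1 expr2; congr (_ + _); apply: eq_bigr => j _; rewrite mulrC.
  have full' : \sum_i \sum_m x i * x m * N m i = t + S.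
    rewrite -full exchange_big; apply: eq_bigr => i _; apply: eq_bigr => j _.
    by rewrite (mulrC (x j)).
  rewrite (_ : 4 * eps * (t + S) = 2 * eps * (t + S) + 2 * eps * (t + S)); last ring.
  rewrite -{1}full -full' !mulr_sumr -big_split /=; apply: eq_bigr => i _.
  by rewrite !mulr_sumr -big_split /=; apply: eq_bigr => j _; ring.
apply: ler_sum => i _; apply: ler_sum => m _; apply: ler_wpM2l => //.
by rewrite mulr_ge0.
Qed.

Lemma quadratic_root_bound (R : realType) (k t S : R) : 0 < k -> k <= 1 ->
  0 <= t -> S ^+ 2 <= 4 * k ^+ 2 * t * (t + S) -> S <= 6 * k * t.
Proof.
move=> k0 k1 t0 le; rewrite leNgt; apply/negP => lt.
have p1 : 0 < (S - 6 * k * t) * S.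
  apply: mulr_gt0; first lra.
  by apply: le_lt_trans lt; rewrite !mulr_ge0 // ltW.
have p2 : 0 <= k * t * (S - 6 * k * t) by rewrite !mulr_ge0 // ?ltW // subr_gt0.
have p3 : 0 <= k * (1 - k) * t * S.
  rewrite !mulr_ge0 ?subr_ge0 // ?(ltW k0) //.
  by apply: ltW; apply: le_lt_trans lt; rewrite !mulr_ge0 // ltW.
have p4 : 0 <= k ^+ 2 * t ^+ 2 by rewrite mulr_ge0 ?sqr_ge0.
by nra.
Qed.

(** * Finite Gram matrices of well separated points *)

Section separated.
Context {R : realType}.
Notation C := (R[i]).
Implicit Types (z w a : C) (c e : nat -> C).

Lemma cmod_oneB_sym z w : cmod (1 - w^* * z) = cmod (1 - z^* * w) :> R.
Proof.
rewrite -[LHS]cmodJ rmorphB rmorph1 [X in 1 - X]rmorphM /= conjCK.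
by rewrite (mulrC w).
Qed.

(** [|1 - conj w * z|] satisfies the triangle inequality on the disc because the
    pseudohyperbolic distance is at most 1. *)
Lemma cmod_oneB_tri z w a : unit_disc z -> unit_disc w -> unit_disc a ->
  cmod (1 - w^* * z) <= cmod (1 - a^* * z) + cmod (1 - w^* * a) :> R.
Proof.
move=> z1 w1 a1.
have -> : 1 - w^* * z = (1 - a^* * z) + z * (a^* - w^*) by ring.
apply: le_trans (cmodD _ _) _; rewrite lerD2l cmodM -rmorphB cmodJ.
have wa0 : 0 < cmod (1 - w^* * a) by exact/cmod_gt0/unit_discM_neq0.
have : cmod (blaschke_factor w a) <= 1 :> R.
  rewrite -(@expr_le1 _ 2) ?cmod_ge0 // -subr_ge0 -nkernel_sqr //.
  exact: sqr_ge0.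
rewrite /blaschke_factor cmodM cmodV ler_pdivrMr // mul1r.
apply: le_trans; rewrite -[leRHS]mul1r ler_wpM2r ?cmod_ge0 //.
exact: ltW.
Qed.

Lemma Re_nkernel z w : unit_disc z -> unit_disc w ->
  complex.Re (nkernel z w) = szego_weight z * szego_weight w / 2 *
    (1 + (1 - cmod w ^+ 2 * cmod z ^+ 2) / cmod (1 - w^* * z) ^+ 2).
Proof.
move=> z1 w1; have nz := unit_discM_neq0 w1 z1.
rewrite /nkernel ReZ -[RHS]mulrA; congr (_ * _).
have D0 := cmod_gt0 nz.
have -> : cmod w ^+ 2 * cmod z ^+ 2 = cmod (w^* * z) ^+ 2.
  by rewrite cmodM cmodJ exprMn.
move: (w^* * z) nz D0 => u nz D0.
have -> : (1 - u)^-1 = ((cmod (1 - u) ^+ 2)^-1)%:C%C * (1 - u)^*.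
  have J0 : (1 - u)^* != 0 by rewrite conjC_eq0.
  by rewrite fmorphV /= cmod_sqrC invfM divfK.
have D2 : cmod (1 - u) ^+ 2 != 0 by rewrite expf_neq0 // gt_eqF.
rewrite ReZ ReJ ReD ReN /=.
have : cmod (1 - u) ^+ 2 = 1 - 2 * complex.Re u + cmod u ^+ 2.
  by rewrite !cmod_sqr; case: (u) => x y /=; ring.
move: (cmod (1 - u) ^+ 2) D2 => d d0 dE.
rewrite (_ : complex.Re u = (1 + cmod u ^+ 2 - d) / 2); last by rewrite dE; field.
by field.
Qed.

Lemma Re_nkernel_ge0 z w : unit_disc z -> unit_disc w ->
  0 <= complex.Re (nkernel z w).
Proof.
move=> z1 w1; rewrite Re_nkernel // mulr_ge0 ?divr_ge0 ?mulr_ge0 ?sqrtr_ge0 //.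
rewrite addr_ge0 ?divr_ge0 ?sqr_ge0 // subr_ge0 -exprMn.
by rewrite exprn_ile1 ?mulr_ge0 ?cmod_ge0 // mulr_ile1 ?cmod_ge0 // ltW.
Qed.

(** The part of the Poisson kernel of [conj w * z] that comes from the height of
    [z] in the bound [1 - |z w|^2 <= (1 - |z|^2) + (1 - |w|^2)]. The two parts
    are kept apart because it is the product of this unsymmetric matrix with its
    transpose that the separation of the points controls. *)
Definition half_poisson z w : R :=
  szego_weight z ^+ 3 * szego_weight w / cmod (1 - w^* * z) ^+ 2.

Lemma Re_nkernel_le z w : unit_disc z -> unit_disc w ->
  complex.Re (nkernel z w) <=
    (szego_weight z * szego_weight w + half_poisson z w + half_poisson w z) / 2.
Proof.
move=> z1 w1; rewrite Re_nkernel // /half_poisson (cmod_oneB_sym w z).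
have D0 : 0 < cmod (1 - w^* * z) by exact/cmod_gt0/unit_discM_neq0.
have rz := szego_weight_sqr z1; have rw := szego_weight_sqr w1.
have := sqrtr_ge0 (1 - cmod z ^+ 2); have := sqrtr_ge0 (1 - cmod w ^+ 2).
rewrite -/(szego_weight z) -/(szego_weight w).
move: (szego_weight z) (szego_weight w) rz rw => r s rz sw s0 r0.
rewrite -subr_ge0 (_ : _ - _ = r * s / 2 / cmod (1 - w^* * z) ^+ 2 *
    (r ^+ 2 + s ^+ 2 - (1 - cmod w ^+ 2 * cmod z ^+ 2))); last first.
  by field; rewrite gt_eqF.
rewrite mulr_ge0 ?divr_ge0 ?mulr_ge0 ?sqr_ge0 ?cmod_ge0 //.
rewrite (_ : cmod w ^+ 2 = 1 - s ^+ 2); last by rewrite sw; ring.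
rewrite (_ : cmod z ^+ 2 = 1 - r ^+ 2); last by rewrite rz; ring.
rewrite (_ : _ - _ = (r * s) ^+ 2); last by ring.
exact: sqr_ge0.
Qed.

Section finite_separated.
Variables (a : nat -> C) (m : nat) (mu : R).
Hypothesis a1 : forall i, unit_disc (a i).
Hypotheses (mu0 : 0 < mu) (mu1 : mu < 1).
Hypothesis sep : forall i : 'I_m,
  \sum_(j < m | j != i) cmod (nkernel (a i) (a j)) ^+ 2 <= mu ^+ 4.
Hypothesis small : \sum_(i < m) szego_weight (a i) ^+ 2 <= mu ^+ 4.

Let mass c : R := \sum_(i < m) cmod (c i) ^+ 2.
Let Q c : R := complex.Re (gram_form a m c).
Let conj c : nat -> C := fun i => (c i)^*.

Let mass_ge0 c : 0 <= mass c.
Proof. by apply: sumr_ge0 => i _; exact: sqr_ge0. Qed.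

Let mu4_lt1 : mu ^+ 4 < 1.
Proof. by rewrite expr_lt1 // ltW. Qed.

Let mass_conj c : mass (conj c) = mass c.
Proof. by apply: eq_bigr => i _; rewrite cmodJ. Qed.

Lemma separated_inj i j : (i < m)%N -> (j < m)%N -> a i = a j -> i = j.
Proof.
move=> im jm aij; apply/eqP/negPn/negP => ij.
have := sep (Ordinal im); rewrite (bigD1 (Ordinal jm)) /=; last first.
  by rewrite -val_eqE /= eq_sym.
rewrite aij nkernel_id // cmod1 expr1n => le.
have : 1 <= mu ^+ 4.
  apply: le_trans le; rewrite lerDl; apply: sumr_ge0 => k _; exact: sqr_ge0.
by rewrite leNgt mu4_lt1.
Qed.

Lemma punctured_product_ge (i : 'I_m) :
  1 - mu ^+ 4 <= cmod (punctured_product a m i) ^+ 2.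
Proof.
rewrite /punctured_product cmod_prod -prodrXl.
apply: (@le_trans _ _ (1 - \sum_(j < m | j != i) cmod (nkernel (a i) (a j)) ^+ 2)).
  by rewrite lerD2l lerN2.
rewrite [leRHS](eq_bigr (fun j : 'I_m => 1 - cmod (nkernel (a i) (a j)) ^+ 2)).
  apply: (@weierstrass_prod _ _ _ (fun j : 'I_m => cmod (nkernel (a i) (a j)) ^+ 2)) => j.
  by rewrite sqr_ge0 nkernel_sqr // gerBl sqr_ge0.
by move=> j _; rewrite nkernel_sqr //; ring.
Qed.

(** Adding the form at the conjugate vector cancels the imaginary part of the
    kernel; the remaining matrix has nonnegative entries, so absolute values may be
    taken. *)
Lemma gram_form_conj_le c :
  Q c + Q (conj c) <= 2 * (1 + mu ^+ 4 / 2 + 6 * mu ^+ 2) * mass c.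
Proof.
pose r (i : 'I_m) := szego_weight (a i).
pose D (i j : 'I_m) := cmod (1 - (a j)^* * a i) ^+ 2.
pose x (i : 'I_m) := cmod (c i).
have r0 i : 0 < r i by exact: szego_weight_gt0.
have D0 i j : 0 < D i j by rewrite exprn_gt0 // cmod_gt0 // unit_discM_neq0.
pose S := \sum_i \sum_(j | j != i) r i ^+ 3 * r j / D i j * (x i * x j).
have S_le : S <= 6 * mu ^+ 2 * mass c.
  apply: quadratic_root_bound; rewrite ?exprn_gt0 // ?exprn_ile1 ?(ltW mu0) ?(ltW mu1) //.
  rewrite -exprM.
  apply: (@positive_kernel_bound R _ r D (mu ^+ 4) x) => //.
  - by move=> i j; rewrite /D cmod_oneB_sym.
  - move=> i; rewrite /D /r [_ * a i]mulrC -szego_weight_sqrC // -rmorphXn /=.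
    by rewrite cmodR ger0_norm ?sqr_ge0 // -exprM.
  - move=> i j k; rewrite /D.
    apply: (@le_trans _ _ ((cmod (1 - (a j)^* * a i) + cmod (1 - (a k)^* * a j)) ^+ 2)).
      by rewrite ler_pXn2r ?nnegrE ?addr_ge0 ?cmod_ge0 // cmod_oneB_tri.
    by have := sqr_ge0 (cmod (1 - (a j)^* * a i) - cmod (1 - (a k)^* * a j)); lra.
  - move=> i; apply: le_trans (sep i); apply: ler_sum => j _.
    by rewrite cmod_nkernel // expr_div_n exprMn.
  - by move=> i; exact: cmod_ge0.
have rx_le : (\sum_i r i * x i) ^+ 2 <= mu ^+ 4 * mass c.
  apply: le_trans (cauchy_schwarz _ _ _) _.
  exact: (ler_wpM2r (mass_ge0 c) small).
pose N i j := r i ^+ 3 * r j / D i j.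
apply: (@le_trans _ _ (2 * mass c + (\sum_i r i * x i) ^+ 2 + S + S)); last first.
  by have := mass_ge0 c; nra.
have -> : Q c + Q (conj c) = \sum_(i < m) \sum_(j < m)
    2 * complex.Re (c i * (c j)^*) * complex.Re (nkernel (a i) (a j)).
  rewrite /Q /gram_form !Re_sum -big_split; apply: eq_bigr => i _ /=.
  rewrite !Re_sum -big_split; apply: eq_bigr => j _ /=.
  rewrite /conj conjCK; move: (c i) (c j) (nkernel _ _).
  by case=> u v [u' v'] [p q] /=; ring.
have -> : 2 * mass c + (\sum_i r i * x i) ^+ 2 + S + S = \sum_(i < m)
    (2 * x i ^+ 2 + \sum_(j < m) (r i * x i) * (r j * x j) +
     \sum_(j | j != i) (N i j + N j i) * (x i * x j)).
  have SE : S = \sum_i \sum_(j | j != i) N j i * (x i * x j).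
    rewrite /S (exchange_big_dep predT) //=; apply: eq_bigr => j _.
    apply: eq_big => [i|i _]; first by rewrite eq_sym.
    by rewrite mulrC [x i * _]mulrC mulrC.
  rewrite {2}SE /S mulr_sumr expr2 big_distrlr /= -!big_split; apply: eq_bigr => i _ /=.
  rewrite -addrA; congr (_ + _); rewrite -big_split /=; apply: eq_bigr => j _.
  by rewrite /N mulrDl.
apply: ler_sum => i _; rewrite (bigD1 i) //= [X in _ <= _ + X + _](bigD1 i) //=.
have termwise (j : 'I_m) : 2 * complex.Re (c i * (c j)^*) * complex.Re (nkernel (a i) (a j))
    <= (r i * x i) * (r j * x j) + (N i j + N j i) * (x i * x j).
  have le1 : complex.Re (c i * (c j)^*) <= x i * x j.
    apply: le_trans (ler_norm _) _; apply: le_trans (Re_le_cmod _) _.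
    by rewrite cmodM cmodJ.
  have le2 := Re_nkernel_le (a1 i) (a1 j).
  have ge := Re_nkernel_ge0 (a1 i) (a1 j).
  have xx : 0 <= x i * x j by rewrite mulr_ge0 ?cmod_ge0.
  apply: (@le_trans _ _ (2 * (x i * x j) * complex.Re (nkernel (a i) (a j)))).
    by apply: ler_wpM2r => //; lra.
  apply: (@le_trans _ _ (2 * (x i * x j) * ((r i * r j + N i j + N j i) / 2))).
    by apply: ler_wpM2l => //; rewrite mulr_ge0.
  by rewrite le_eqVlt; apply/orP; left; apply/eqP; field.
have : \sum_(j | j != i) 2 * complex.Re (c i * (c j)^*) *
    complex.Re (nkernel (a i) (a j)) <= \sum_(j | j != i) (r i * x i) * (r j * x j) +
   \sum_(j | j != i) (N i j + N j i) * (x i * x j).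
  by rewrite -big_split; apply: ler_sum => j _; exact: termwise.
have : complex.Re (c i * (c i)^*) = x i ^+ 2 by rewrite -cmod_sqrC.
rewrite nkernel_id //= => ->; have := sqr_ge0 (r i * x i); rewrite mulr1 expr2; lra.
Qed.

(** Apply [pairing_le] with [e_i] the conjugate of [beta_i c_i]. *)
Lemma gram_form_duality L c : 0 < L -> (forall e, Q e <= L * mass e) ->
  (1 - mu ^+ 4) / L * mass c <= Q c.
Proof.
move=> L0 LQ; pose e i := (punctured_product a m i * c i)^*.
pose P := \sum_(i < m) cmod (punctured_product a m i * c i) ^+ 2.
have PE : \sum_(i < m) punctured_product a m i * c i * e i = P%:C%C.
  by rewrite rmorph_sum; apply: eq_bigr => i _; rewrite /= cmod_sqrC.
have P0 : 0 <= P by apply: sumr_ge0 => i _; exact: sqr_ge0.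
have := pairing_le a1 separated_inj c e; rewrite PE cmodR ger0_norm // -/(Q c) -/(Q e).
have Qc0 : 0 <= Q c by exact: gram_form_ge0.
have /(ler_wpM2l Qc0) le2 : Q e <= L * P.
  by rewrite (_ : P = mass e) //; apply: eq_bigr => i _; rewrite cmodJ.
move=> /le_trans /(_ le2) le3.
have le4 : (1 - mu ^+ 4) * mass c <= P.
  rewrite mulr_sumr; apply: ler_sum => i _; rewrite cmodM exprMn.
  by rewrite ler_wpM2r ?sqr_ge0 // punctured_product_ge.
rewrite mulrAC ler_pdivrMr //; apply: (le_trans le4).
move: P0; rewrite le_eqVlt => /predU1P[<-|P0]; first by rewrite mulr_ge0 // ltW.
by rewrite -(ler_pM2r P0) -expr2; apply: le_trans le3 _; rewrite mulrA.
Qed.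

(** An upper bound [L] of the form gives a lower bound by [gram_form_duality], and
    then a better upper bound by [gram_form_conj_le]. The infimum of the upper
    bounds cannot be improved, so it is a point between the roots of a quadratic
    polynomial with a nearly double root at 1. *)
Lemma gram_form_le c : Q c <= (1 + 15 * mu) * mass c.
Proof.
pose eta := mu ^+ 4 / 2 + 6 * mu ^+ 2.
have eta0 : 0 < eta.
  by rewrite addr_gt0 ?divr_gt0 ?mulr_gt0 ?exprn_gt0.
have Q0 e : 0 <= Q e by exact: gram_form_ge0.
pose U : set R := [set L | 1 <= L /\ forall e, Q e <= L * mass e].
have U0 : U (2 * (1 + eta)).
  (* The form is nonnegative, so its value at the conjugate vector can be dropped. *)
  split=> [|e]; first lra.
  by have := gram_form_conj_le e; have := Q0 (conj e); rewrite /eta; lra.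
have lbU : lbound U 1 by move=> L [].
have infU : has_inf U by split; [exists (2 * (1 + eta)) | exists 1].
have step L : U L -> inf U <= 2 * (1 + eta) - (1 - mu ^+ 4) / L.
  move=> [L1 LQ].
  have [le|gt] := leP 1 (2 * (1 + eta) - (1 - mu ^+ 4) / L); last first.
    exfalso; move: gt; apply/negP; rewrite -leNgt.
    have : (1 - mu ^+ 4) / L <= 1.
      rewrite ler_pdivrMr ?mul1r; last exact: lt_le_trans L1.
      by apply: le_trans L1; rewrite gerBl exprn_ge0 // ltW.
    lra.
  apply: ge_inf; first by exists 1.
  split=> // e; have := gram_form_conj_le e; rewrite -/eta.
  have := gram_form_duality (conj e) (lt_le_trans ltr01 L1) LQ.
  rewrite mass_conj /eta; lra.
pose I := inf U.
have I1 : 1 <= I by apply: lb_le_inf => //; exists (2 * (1 + eta)).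
(* Were this false, an upper bound close enough to [I] would improve below [I]. *)
have Iquad : I * I <= 2 * (1 + eta) * I - (1 - mu ^+ 4).
  rewrite leNgt; apply/negP => lt.
  pose d := (I * I - (2 * (1 + eta) * I - (1 - mu ^+ 4))) / (2 * (1 + eta) + 1).
  have d0 : 0 < d by rewrite divr_gt0 //; lra.
  have [L UL Ld] := inf_adherent d0 infU.
  have L1 := UL.1; have L0 : 0 < L by exact: lt_le_trans L1.
  have := step L UL; rewrite -/I -(ler_pM2r L0) mulrBl divfK ?gt_eqF // => st.
  have IL : I <= L by apply: ge_inf => //; exists 1.
  have dE : d * (2 * (1 + eta) + 1) = I * I - (2 * (1 + eta) * I - (1 - mu ^+ 4)).
    by rewrite /d divfK // gt_eqF //; lra.
  have e1 : I * I <= I * L by rewrite ler_wpM2l //; lra.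
  have e2 : 2 * (1 + eta) * L <= 2 * (1 + eta) * (I + d).
    by apply: ler_wpM2l; [lra | exact: ltW].
  have Ld' : L < I + d by [].
  have e3 : 0 <= d by exact: ltW.
  by nra.
have Ile : I <= 1 + 15 * mu.
  rewrite leNgt; apply/negP => lt.
  have m20 : 0 <= mu ^+ 2 by exact: sqr_ge0.
  have m2 : mu ^+ 2 <= mu by rewrite expr2 ler_piMr ?ltW.
  have m4 : mu ^+ 4 <= mu ^+ 2.
    by rewrite (exprM _ 2 2) expr2 ler_piMr ?sqr_ge0 // exprn_ile1 // ltW.
  have etale : eta <= 7 * mu ^+ 2 by rewrite /eta; lra.
  have etale' : eta <= 7 * mu by lra.
  have sq : (I - 1 - eta) ^+ 2 <= 2 * eta + eta ^+ 2 + mu ^+ 4 by nra.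
  have eta2 : eta ^+ 2 <= 49 * mu ^+ 2.
    rewrite (_ : 49 * mu ^+ 2 = (7 * mu) ^+ 2); last by ring.
    by rewrite ler_pXn2r // nnegrE; lra.
  have : (8 * mu + (I - 1 - eta - 8 * mu)) ^+ 2 <= 64 * mu ^+ 2.
    by rewrite (_ : 8 * mu + _ = I - 1 - eta); [lra | ring].
  apply/negP; rewrite -ltNge (_ : 64 * mu ^+ 2 = (8 * mu) ^+ 2); last by ring.
  by rewrite ltr_pXn2r // ?nnegrE; lra.
apply: le_trans (_ : I * mass c <= _); last by rewrite ler_wpM2r.
have [mc|mc] := eqVneq (mass c) 0.
  by have := U0.2 c; rewrite mc !mulr0.
have mc0 : 0 < mass c by rewrite lt0r mc mass_ge0.
rewrite -ler_pdivrMr //; apply: lb_le_inf; first by exists (2 * (1 + eta)).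
by move=> L [_ /(_ c)]; rewrite ler_pdivrMr.
Qed.

Lemma gram_form_near_identity c : `|Q c - mass c| <= 16 * mu * mass c.
Proof.
rewrite ler_norml; apply/andP; split; last first.
  have := gram_form_le c; have : 0 <= mu * mass c by rewrite mulr_ge0 ?mass_ge0 ?ltW.
  lra.
have L0 : 0 < 1 + 15 * mu by rewrite addr_gt0 ?mulr_gt0.
have := gram_form_duality c L0 gram_form_le; rewrite -subr_ge0 => le.
suff : 1 - 16 * mu <= (1 - mu ^+ 4) / (1 + 15 * mu).
  move/(ler_wpM2r (mass_ge0 c)); move: le; lra.
rewrite ler_pdivlMr //.
have m4 : mu ^+ 4 <= mu.
  by rewrite (exprS _ 3) ler_piMr ?exprn_ile1 ?(ltW mu0) ?(ltW mu1).
by have := sqr_ge0 mu; nra.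
Qed.

End finite_separated.
End separated.

(** * Operators on square-summable sequences given by a matrix *)

Section matrix_bound.
Context {R : realType}.
Notation C := (R[i]).
Implicit Types (x y c : nat -> C).

(** Polarization between [x] and [y / eta], with [y = H x]. *)
Lemma hermitian_norm_bound (m : nat) (H : nat -> nat -> C) (eta : R) :
  0 < eta -> (forall i j, (H i j)^* = H j i) ->
  (forall c, `|complex.Re (\sum_(i < m) \sum_(j < m) c i * (c j)^* * H i j)| <=
     eta * \sum_(i < m) cmod (c i) ^+ 2) ->
  forall x, \sum_(i < m) cmod (\sum_(j < m) H i j * x j) ^+ 2 <=
     eta ^+ 2 * \sum_(i < m) cmod (x i) ^+ 2.
Proof.
move=> eta0 Hherm Hform x.
pose y i := \sum_(j < m) H i j * x j.
pose B c := complex.Re (\sum_(i < m) \sum_(j < m) c i * (c j)^* * H i j).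
pose s : C := (eta^-1)%:C%C.
have sJ : s^* = s by exact: conj_real_complex.
pose u i := (x i + s * y i)^*; pose v i := (x i - s * y i)^*.
pose X := \sum_(i < m) cmod (x i) ^+ 2; pose Y := \sum_(i < m) cmod (y i) ^+ 2.
have polar : B u - B v = 4 * eta^-1 * Y.
  have YE : \sum_(i < m) \sum_(j < m) (y i)^* * x j * H i j = Y%:C%C.
    rewrite rmorph_sum; apply: eq_bigr => i _ /=; rewrite cmod_sqrC mulrC.
    by rewrite /y mulr_sumr; apply: eq_bigr => j _; rewrite -mulrA [x j * _]mulrC.
  have YE' : \sum_(i < m) \sum_(j < m) (x i)^* * y j * H i j = Y%:C%C.
    rewrite -[RHS]conj_real_complex -YE rmorph_sum exchange_big /=.
    apply: eq_bigr => i _; rewrite rmorph_sum; apply: eq_bigr => j _ /=.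
    rewrite [RHS]rmorphM /= Hherm [X in _ = X * _]rmorphM /= conjCK.
    by rewrite [(x j)^* * _]mulrC.
  have -> : 4 * eta^-1 * Y = complex.Re (2 * s * (Y%:C%C + Y%:C%C)).
    rewrite (_ : 2 * s * _ = (4 * eta^-1 * Y)%:C%C) //.
    by rewrite /s !rmorphM /= !rmorph_nat; ring.
  rewrite /B -ReN -ReD; congr (complex.Re _).
  rewrite -{1}YE -YE' -big_split mulr_sumr -sumrB; apply: eq_bigr => i _ /=.
  rewrite -big_split mulr_sumr -sumrB; apply: eq_bigr => j _ /=.
  rewrite /u /v !conjCK.
  have -> : (x i + s * y i)^* = (x i)^* + s * (y i)^*.
    by rewrite rmorphD [X in _ + X]rmorphM /= sJ.
  have -> : (x i - s * y i)^* = (x i)^* - s * (y i)^*.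
    by rewrite rmorphB [X in _ - X]rmorphM /= sJ.
  by ring.
have parallelogram : \sum_(i < m) cmod (u i) ^+ 2 + \sum_(i < m) cmod (v i) ^+ 2 =
    2 * X + 2 * eta^-1 ^+ 2 * Y.
  rewrite /X /Y !mulr_sumr -!big_split; apply: eq_bigr => i _ /=.
  rewrite /u /v !cmodJ !cmod_sqr /s; case: (x i) (y i) => a b [d e] /=.
  by ring.
have /ler_normlP [_ le1] := Hform u; have /ler_normlP [le2 _] := Hform v.
have le : 4 * eta^-1 * Y <= eta * (2 * X + 2 * eta^-1 ^+ 2 * Y).
  rewrite -polar -parallelogram mulrDr; apply: lerD; first exact: le1.
  exact: le2.
have := ler_wpM2l (ltW eta0) le.
have -> : eta * (4 * eta^-1 * Y) = 4 * Y by field; rewrite gt_eqF.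
have -> : eta * (eta * (2 * X + 2 * eta^-1 ^+ 2 * Y)) = 2 * (eta ^+ 2 * X) + 2 * Y.
  by field; rewrite gt_eqF.
by rewrite -/X -/Y; lra.
Qed.

Lemma cvg_tail_small (u : R^nat) (e : R) : (forall n, 0 <= u n) ->
  cvgn (series u) -> 0 < e -> exists N, forall n, \sum_(N <= i < n) u i <= e.
Proof.
move=> u0 cu e0.
have nd : nondecreasing_seq (series u) by apply: nondecreasing_series => k _ _.
have [N _ /(_ N (leqnn N)) leN] : \forall n \near \oo, limn (series u) - e <= series u n.
  have /cvgrPdist_le /(_ e e0) := cu; apply: filterS => n.
  by rewrite ler_norml => /andP[_]; rewrite lerBlDr addrC -lerBlDr.
exists N => n; have [le|lt] := leqP n N; first by rewrite big_geq // ltW.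
have := nondecreasing_cvgn_le nd cu n.
rewrite {1}/series /= (@big_cat_nat _ _ _ N) //= ?(ltnW lt) //.
move: leN; rewrite /series /=; lra.
Qed.

Lemma is_cvg_series_sum (m : nat) (u : nat -> R^nat) :
  (forall j, cvgn (series (u j))) ->
  cvgn (series (fun i => \sum_(j < m) u j i)).
Proof.
move=> cu; elim: m => [|m IH].
  rewrite (_ : series _ = fun=> 0); first exact: is_cvg_cst.
  by apply/funext => n; rewrite /series /= big1 // => i _; rewrite big_ord0.
have := is_cvg_seriesD IH (cu m).
by congr (cvgn (series _)); apply/funext => i; rewrite big_ord_recr.
Qed.

Lemma le_big_nat (u : R^nat) a b a' b' : (forall i, 0 <= u i) ->
  (a' <= a)%N -> (b <= b')%N -> \sum_(a <= i < b) u i <= \sum_(a' <= i < b') u i.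
Proof.
move=> u0 aa bb; have [ba|ab] := leqP b a.
  by rewrite big_geq //; apply: sumr_ge0.
rewrite (@big_cat_nat _ _ _ a a') //=; last exact: leq_trans (ltnW ab) bb.
rewrite (@big_cat_nat _ _ _ b a b') //= ?(ltnW ab) //.
have : 0 <= \sum_(a' <= i < a) u i by apply: sumr_ge0.
have : 0 <= \sum_(b <= i < b') u i by apply: sumr_ge0.
lra.
Qed.

Section tails.
Variable H : nat -> nat -> C.
Hypothesis Hrow : forall i, square_summable (H i).
Hypothesis Hcol : forall j, square_summable (H^~ j).
Hypothesis Htail : forall e : R, 0 < e -> exists N, forall n x,
  \sum_(N <= i < n) cmod (\sum_(N <= j < n) H i j * x j) ^+ 2 <=
  e * \sum_(N <= j < n) cmod (x j) ^+ 2.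

Let sq0 (u : nat -> C) n : 0 <= cmod (u n) ^+ 2. Proof. exact: sqr_ge0. Qed.

Lemma cauchy_schwarz_nat (u v : nat -> C) a b :
  cmod (\sum_(a <= j < b) u j * v j) ^+ 2 <=
  (\sum_(a <= j < b) cmod (u j) ^+ 2) * (\sum_(a <= j < b) cmod (v j) ^+ 2).
Proof. by rewrite !(big_addn 0 b a) !big_mkord; exact: cauchy_schwarz_cmod. Qed.

(** The first columns contribute little to late rows since they are
    square-summable; the other columns are controlled by the tail sections. *)
Lemma matrix_tail (e : R) : 0 < e -> exists N, forall n x,
  \sum_(N <= i < n) cmod (\sum_(0 <= j < n) H i j * x j) ^+ 2 <=
  e * \sum_(0 <= j < n) cmod (x j) ^+ 2.
Proof.
move=> e0; have e4 : 0 < e / 4 by rewrite divr_gt0.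
have [N HN] := Htail e4.
have cs : cvgn (series (fun i => \sum_(j < N) cmod (H i j) ^+ 2)).
  exact: (@is_cvg_series_sum N (fun j i => cmod (H i j) ^+ 2) Hcol).
have pos i : 0 <= \sum_(j < N) cmod (H i j) ^+ 2 by apply: sumr_ge0.
have [N1 HN1] := cvg_tail_small pos cs e4.
pose N' := maxn N N1; exists N' => n x.
set X := \sum_(0 <= j < n) cmod (x j) ^+ 2.
have X0 : 0 <= X by apply: sumr_ge0 => j _; exact: sq0.
have [le|lt] := leqP n N'; first by rewrite big_geq // mulr_ge0 // ltW.
have Nn : (N <= n)%N by apply: leq_trans (ltnW lt); exact: leq_maxl.
apply: (@le_trans _ _ (\sum_(N' <= i < n)
    (2 * (\sum_(j < N) cmod (H i j) ^+ 2) * X +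
     2 * cmod (\sum_(N <= j < n) H i j * x j) ^+ 2))).
  apply: ler_sum => i _; rewrite (@big_cat_nat _ _ _ N) //=.
  apply: le_trans (cmodD_sqr _ _) _; rewrite lerD2r -mulrA ler_wpM2l //.
  apply: le_trans (cauchy_schwarz_nat _ _ _ _) _.
  rewrite big_mkord ler_wpM2l //; exact: (le_big_nat (sq0 x)).
rewrite big_split /= -mulr_suml -!mulr_sumr.
have le1 : \sum_(N' <= i < n) \sum_(j < N) cmod (H i j) ^+ 2 <= e / 4.
  apply: le_trans (HN1 n); apply: le_big_nat => //; exact: leq_maxr.
have le2 : \sum_(N' <= i < n) cmod (\sum_(N <= j < n) H i j * x j) ^+ 2 <= e / 4 * X.
  apply: le_trans (le_trans (HN n x) _).
    by apply: (le_big_nat (sq0 (fun i => \sum_(N <= j < n) H i j * x j))) => //; exact: leq_maxl.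
  rewrite ler_wpM2l ?(ltW e4) //; exact: (le_big_nat (sq0 x)).
by have := ler_wpM2r X0 le1; lra.
Qed.

Lemma matrix_bounded : exists2 M : R, 0 <= M & forall n x,
  \sum_(0 <= i < n) cmod (\sum_(0 <= j < n) H i j * x j) ^+ 2 <=
  M * \sum_(0 <= j < n) cmod (x j) ^+ 2.
Proof.
have [N HN] := matrix_tail ltr01.
have rows0 i : 0 <= sqnorm (H i) by exact/sqnorm_ge0/Hrow.
exists (\sum_(0 <= i < N) sqnorm (H i) + 1) => [|n x].
  by rewrite addr_ge0 // sumr_ge0.
set X := \sum_(0 <= j < n) cmod (x j) ^+ 2.
have X0 : 0 <= X by apply: sumr_ge0 => j _; exact: sq0.
pose y i := \sum_(0 <= j < n) H i j * x j.
apply: (@le_trans _ _ (\sum_(0 <= i < N) cmod (y i) ^+ 2 +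
    \sum_(N <= i < n) cmod (y i) ^+ 2)).
  have [le|lt] := leqP n N.
    rewrite -[leLHS]addr0 lerD //; last by apply: sumr_ge0 => i _; exact: sq0.
    exact: (le_big_nat (sq0 y)).
  by rewrite (@big_cat_nat _ _ _ N) //= ltnW.
rewrite mulrDl; apply: lerD; last exact: HN.
rewrite mulr_suml; apply: ler_sum => i _.
apply: le_trans (cauchy_schwarz_nat _ _ _ _) _; apply: ler_wpM2r => //.
apply: (@nondecreasing_cvgn_le _ (series (fun j => cmod (H i j) ^+ 2))).
  by apply: nondecreasing_series => k _ _; exact: sq0.
exact: Hrow.
Qed.

End tails.
End matrix_bound.

Section convergence.
Context {R : realType}.
Notation C := (R[i]).

(** Convergence of real and imaginary parts reduces completeness and
    compactness in the complex plane to the real line. *)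
Definition cvg_parts {T : Type} (F : set_system T) (f : T -> C) (l : C) : Prop :=
  ((fun t => complex.Re (f t)) @ F --> complex.Re l) /\
  ((fun t => complex.Im (f t)) @ F --> complex.Im l).

Lemma cvg_parts_unique (T : Type) (F : set_system T) (f : T -> C) (l l' : C) :
  ProperFilter F -> cvg_parts F f l -> cvg_parts F f l' -> l = l'.
Proof.
move=> FF [r i] [r' i']; apply/eqP; rewrite eq_complex.
rewrite (cvg_unique (@norm_hausdorff R R) r r').
by rewrite (cvg_unique (@norm_hausdorff R R) i i') !eqxx.
Qed.

Lemma cvg_parts_cst (T : Type) (F : set_system T) (l : C) :
  Filter F -> cvg_parts F (fun=> l) l.
Proof. by move=> FF; split; exact: cvg_cst. Qed.

Lemma cvg_partsD (T : Type) (F : set_system T) (f g : T -> C) (l k : C) :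
  Filter F -> cvg_parts F f l -> cvg_parts F g k ->
  cvg_parts F (fun t => f t + g t) (l + k).
Proof.
move=> FF [r i] [r' i']; split.
  by rewrite ReD; under eq_fun do rewrite ReD; exact: cvgD.
by rewrite ImD; under eq_fun do rewrite ImD; exact: cvgD.
Qed.

Lemma cvg_partsZ (T : Type) (F : set_system T) (z : C) (f : T -> C) (l : C) :
  Filter F -> cvg_parts F f l -> cvg_parts F (fun t => z * f t) (z * l).
Proof.
case: z => a b FF [r i]; split.
  have -> : complex.Re ((a +i* b)%C * l) = a * complex.Re l - b * complex.Im l.
    by case: l {r i}.
  rewrite (_ : (fun t => _) = fun t => a * complex.Re (f t) - b * complex.Im (f t)).
    by apply: cvgB; apply: cvgM => //; exact: cvg_cst.
  by apply/funext => t; case: (f t).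
have -> : complex.Im ((a +i* b)%C * l) = a * complex.Im l + b * complex.Re l.
  by case: l {r i} => x y /=; ring.
rewrite (_ : (fun t => _) = fun t => a * complex.Im (f t) + b * complex.Re (f t)).
  by apply: cvgD; apply: cvgM => //; exact: cvg_cst.
by apply/funext => t; case: (f t) => x y /=; ring.
Qed.

Lemma cvg_parts_cmod (T : Type) (F : set_system T) (f : T -> C) (l : C) :
  Filter F -> cvg_parts F f l ->
  (fun t => cmod (f t) ^+ 2) @ F --> cmod l ^+ 2.
Proof.
move=> FF [r i]; rewrite cmod_sqr; under eq_fun do rewrite cmod_sqr.
by apply: cvgD; rewrite expr2; under eq_fun do rewrite expr2; exact: cvgM.
Qed.

Lemma cvg_parts_sum_cmod (T : Type) (F : set_system T) (f : nat -> T -> C)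
    (l : nat -> C) a b : Filter F -> (forall i, cvg_parts F (f i) (l i)) ->
  (fun t => \sum_(a <= i < b) cmod (f i t) ^+ 2) @ F -->
  \sum_(a <= i < b) cmod (l i) ^+ 2.
Proof.
move=> FF fl; elim: (index_iota a b) => [|i s IH].
  by rewrite big_nil; under eq_fun do rewrite big_nil; exact: cvg_cst.
rewrite big_cons; under eq_fun do rewrite big_cons.
by apply: cvgD => //; exact: cvg_parts_cmod.
Qed.

Lemma ultra_cvg_bounded (T : Type) (F : set_system T) (f : T -> R) (M : R) :
  UltraFilter F -> F [set t | `|f t| <= M] -> exists r : R, f t @[t --> F] --> r.
Proof.
move=> UF FM; have PF : ProperFilter F by exact: ultra_proper.
have FI : F (f @^-1` `[- M, M]).
  by apply: filterS FM => t /=; rewrite in_itv /= -ler_norml.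
have [r [_ clr]] := @segment_compact R (- M) M (fmap f F) _ FI.
exists r => V rV; have [//|FVc] := in_ultra_setVsetC (f @^-1` V) UF.
by have [x []] := clr (~` V) V FVc rV.
Qed.


Lemma sqnorm_partial_le (u : nat -> C) a b : square_summable u ->
  \sum_(a <= i < b) cmod (u i) ^+ 2 <= sqnorm u.
Proof.
move=> su; apply: (@le_trans _ _ (series (fun n => cmod (u n) ^+ 2) b)).
  by apply: (@le_big_nat _ (fun n => cmod (u n) ^+ 2)) => // i; exact: sqr_ge0.
apply: nondecreasing_cvgn_le => //.
by apply: nondecreasing_series => k _ _; exact: sqr_ge0.
Qed.

Lemma square_summable_bounded (u : nat -> C) (M : R) :
  (forall n, \sum_(0 <= i < n) cmod (u i) ^+ 2 <= M) ->
  square_summable u /\ sqnorm u <= M.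
Proof.
move=> uM; have cu : square_summable u.
  apply: nondecreasing_is_cvgn.
    by apply: nondecreasing_series => k _ _; exact: sqr_ge0.
  by exists M => _ [n _ <-]; exact: uM.
by split => //; apply: limr_le => //; apply: nearW => n; exact: uM.
Qed.

Lemma cvg_parts_series (u v : nat -> C) : square_summable u -> square_summable v ->
  exists l, cvg_parts \oo (fun n => \sum_(0 <= j < n) u j * v j) l.
Proof.
move=> su sv.
pose w : R^nat := (fun n => cmod (u n) ^+ 2) + (fun n => cmod (v n) ^+ 2).
have cw : cvgn (series w) by exact: is_cvg_seriesD.
have part (p : C -> R) : (forall z, `|p z| <= cmod z) ->
    cvgn (series (fun j => p (u j * v j))).
  move=> p_le; apply: normed_cvg; apply: (series_le_cvg _ _ _ cw) => n //=.
    by apply: addr_ge0; exact: sqr_ge0.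
  apply: le_trans (p_le _) _; rewrite cmodM.
  rewrite [leRHS](_ : _ = cmod (u n) ^+ 2 + cmod (v n) ^+ 2) //.
  have := sqr_ge0 (cmod (u n) - cmod (v n)).
  by have := mulr_ge0 (cmod_ge0 (u n)) (cmod_ge0 (v n)); lra.
have cr := part _ Re_le_cmod; have ci := part _ Im_le_cmod.
exists (Complex (limn (series (fun j => complex.Re (u j * v j))))
  (limn (series (fun j => complex.Im (u j * v j))))).
by split => /=; [under eq_fun do rewrite Re_sum|under eq_fun do rewrite Im_sum].
Qed.

Lemma ell2_normE (x : ell2 R) : `|x| = (Num.sqrt (sqnorm x))%:C%C.
Proof. by []. Qed.

Lemma ell2_norm_le (x : ell2 R) (M : R) : 0 <= M ->
  (`|x| <= M%:C%C) = (sqnorm x <= M ^+ 2).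
Proof.
move=> M0; rewrite ell2_normE lecR -[RHS]ler_sqrt ?sqr_ge0 //.
by rewrite sqrtr_sqr ger0_norm.
Qed.

(** An ultrafilter on this set converges coordinatewise, since the coordinates are
    bounded; uniformly small tails make the convergence hold in norm. *)
Lemma compact_small_tails (M : R) (N : nat -> nat) :
  compact [set x : ell2 R | (forall n, \sum_(0 <= i < n) cmod (x i) ^+ 2 <= M) /\
    forall k n, \sum_(N k <= i < n) cmod (x i) ^+ 2 <= k.+1%:R^-1].
Proof.
rewrite compact_ultra => F UF FA.
have PF : ProperFilter F by exact: ultra_proper.
have coord_le (x : ell2 R) i : (forall n, \sum_(0 <= i < n) cmod (x i) ^+ 2 <= M) ->
    cmod (x i) <= Num.sqrt M.
  move=> /(_ i.+1) le; rewrite -[leLHS]ger0_norm ?cmod_ge0 // -sqrtr_sqr.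
  apply: ler_wsqrtr; apply: le_trans le; rewrite big_nat_recr //= lerDr.
  by apply: sumr_ge0 => k _; exact: sqr_ge0.
have coord i : exists l, cvg_parts F (fun x : ell2 R => x i) l.
  have [|r cr] := @ultra_cvg_bounded _ F (fun x : ell2 R => complex.Re (x i)) (Num.sqrt M) UF.
    by apply: filterS FA => x [xM _] /=; apply: le_trans (Re_le_cmod _) (coord_le _ _ _).
  have [|s cs] := @ultra_cvg_bounded _ F (fun x : ell2 R => complex.Im (x i)) (Num.sqrt M) UF.
    by apply: filterS FA => x [xM _] /=; apply: le_trans (Im_le_cmod _) (coord_le _ _ _).
  by exists (Complex r s).
have [l cl] := choice coord.
have lim_sum a b : (fun x : ell2 R => \sum_(a <= i < b) cmod (x i) ^+ 2) @ F -->
    \sum_(a <= i < b) cmod (l i) ^+ 2 by exact: cvg_parts_sum_cmod.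
have lM n : \sum_(0 <= i < n) cmod (l i) ^+ 2 <= M.
  apply: (cvgr_to_le (lim_sum 0%N n)).
  by apply: filterS FA => x [].
have lN k n : \sum_(N k <= i < n) cmod (l i) ^+ 2 <= k.+1%:R^-1.
  apply: (cvgr_to_le (lim_sum (N k) n)).
  by apply: filterS FA => x [].
have [sl _] := square_summable_bounded lM.
have l2 : l \in ell2_pred by exact: asboolT.
exists (Ell2 l2); split => //=.
apply/cvgrPdist_le => e e0.
have eE : e = (cmod e)%:C%C by rewrite cmodE gtr0_norm.
have e'0 : 0 < cmod e by rewrite -ltcR -eE.
have [k ke] : exists k, 4 * k.+1%:R^-1 <= cmod e ^+ 2 / 2.
  have d0 : 0 < cmod e ^+ 2 / 8 by rewrite divr_gt0 ?exprn_gt0.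
  have [k _ /(_ k (leqnn k)) lt] := near_infty_natSinv_lt (PosNum d0).
  exists k; have {}lt : k.+1%:R^-1 < cmod e ^+ 2 / 8 by [].
  by move: lt; move: (cmod e ^+ 2) (k.+1%:R^-1) => p q; lra.
have near0 : (fun x : ell2 R => \sum_(0 <= i < N k) cmod (l i + - 1 * x i) ^+ 2) @ F -->
    \sum_(0 <= i < N k) cmod (l i + - 1 * l i) ^+ 2.
  apply: (@cvg_parts_sum_cmod _ _ (fun i (x : ell2 R) => l i + - 1 * x i)) => i.
  by apply: cvg_partsD; [exact: cvg_parts_cst|exact: cvg_partsZ].
have : F [set x : ell2 R | \sum_(0 <= i < N k) cmod (l i + - 1 * x i) ^+ 2 <=
    cmod e ^+ 2 / 2].
  apply: (cvgr_le _ near0); rewrite big1 ?divr_gt0 ?exprn_gt0 // => i _.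
  by rewrite mulN1r subrr cmod0 expr0n.
apply: filterS2 FA => x [xM xN] small.
rewrite eE ell2_norm_le ?cmod_ge0 //.
have dE i : (Ell2 l2 - x) i = l i + - 1 * x i by rewrite mulN1r.
suff bound n : \sum_(0 <= i < n) cmod ((Ell2 l2 - x) i) ^+ 2 <= cmod e ^+ 2.
  by have [] := square_summable_bounded bound.
have tail : \sum_(N k <= i < n) cmod ((Ell2 l2 - x) i) ^+ 2 <= cmod e ^+ 2 / 2.
  apply: le_trans ke; apply: (@le_trans _ _ (\sum_(N k <= i < n)
      (2 * cmod (l i) ^+ 2 + 2 * cmod (x i) ^+ 2))).
    apply: ler_sum => i _; apply: le_trans (cmodD_sqr _ _) _.
    by rewrite cmodN.
  by rewrite big_split /= -!mulr_sumr; move: (lN k n) (xN k n); move: (k.+1%:R^-1) => q; lra.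
have head : \sum_(0 <= i < N k) cmod ((Ell2 l2 - x) i) ^+ 2 <= cmod e ^+ 2 / 2.
  by under eq_bigr do rewrite dE.
have [le|lt] := leqP n (N k).
  apply: (@le_trans _ _ (cmod e ^+ 2 / 2)); last by have := sqr_ge0 (cmod e); lra.
  apply: le_trans head.
  by apply: (@le_big_nat _ (fun i => cmod ((Ell2 l2 - x) i) ^+ 2)) => // i; exact: sqr_ge0.
by rewrite (@big_cat_nat _ _ _ (N k)) //= ?(ltnW lt) //; lra.
Qed.

End convergence.

Section operator.
Context {R : realType}.
Notation C := (R[i]).

(** The image of [x] is the coordinatewise limit of the products of [x] with the
    finite sections of the matrix, so it inherits their bounds. *)
Lemma compact_matrix_operator (H : nat -> nat -> C) :
  (forall i, square_summable (H i)) -> (forall j, square_summable (H^~ j)) ->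
  (forall e : R, 0 < e -> exists N, forall n (x : nat -> C),
    \sum_(N <= i < n) cmod (\sum_(N <= j < n) H i j * x j) ^+ 2 <=
    e * \sum_(N <= j < n) cmod (x j) ^+ 2) ->
  exists K : {linear ell2 R -> ell2 R},
    [/\ compact_operator K, bounded_operator K &
      forall i j, K (ell2_basis j) i = H i j].
Proof.
move=> Hrow Hcol Htail.
have [M M0 HM] := matrix_bounded Hrow Hcol Htail.
have lim_coord (x : ell2 R) i :
    exists l, cvg_parts \oo (fun n => \sum_(0 <= j < n) H i j * x j) l.
  by apply: cvg_parts_series => //; exact: ell2P.
have [k_ kP] := choice (fun xi : ell2 R * nat => lim_coord xi.1 xi.2).
pose k (x : ell2 R) i := k_ (x, i).
have {}kP (x : ell2 R) i : cvg_parts \oo (fun n => \sum_(0 <= j < n) H i j * x j) (k x i).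
  exact: (kP (x, i)).
have pass a b (B : R) (x : ell2 R) : 0 <= B ->
    (forall n (x : nat -> C), \sum_(a <= i < n) cmod (\sum_(0 <= j < n) H i j * x j) ^+ 2
       <= B * \sum_(0 <= j < n) cmod (x j) ^+ 2) ->
    \sum_(a <= i < b) cmod (k x i) ^+ 2 <= B * sqnorm x.
  move=> B0 HB.
  have lim : (fun n => \sum_(a <= i < b) cmod (\sum_(0 <= j < n) H i j * x j) ^+ 2)
      @ \oo --> \sum_(a <= i < b) cmod (k x i) ^+ 2.
    exact: (@cvg_parts_sum_cmod _ _ _ (fun i n => \sum_(0 <= j < n) H i j * x j)).
  apply: (cvgr_to_le lim).
  exists b => // n /= bn; apply: (@le_trans _ _ (B * \sum_(0 <= j < n) cmod (x j) ^+ 2)).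
    apply: le_trans (HB n x).
    apply: (@le_big_nat _ (fun i => cmod (\sum_(0 <= j < n) H i j * x j) ^+ 2)) => // i.
    exact: sqr_ge0.
  by apply: ler_wpM2l => //; apply: sqnorm_partial_le; exact: ell2P.
have kM (x : ell2 R) n : \sum_(0 <= i < n) cmod (k x i) ^+ 2 <= M * sqnorm x by exact: pass.
have k2 (x : ell2 R) : k x \in ell2_pred.
  by apply: asboolT; have [] := square_summable_bounded (kM x).
pose f x := Ell2 (k2 x).
have flin : linear f.
  move=> z x y; apply: val_inj; apply/funext => i /=.
  apply: (cvg_parts_unique _ (kP (z *: x + y) i)).
  rewrite (_ : (fun n => _) = fun n => z * (\sum_(0 <= j < n) H i j * x j) +
      \sum_(0 <= j < n) H i j * y j).
    by apply: cvg_partsD; [exact: cvg_partsZ | exact: kP].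
  apply/funext => n; rewrite mulr_sumr -big_split; apply: eq_bigr => j _ /=.
  by rewrite mulrDr mulrCA.
pose K : {linear ell2 R -> ell2 R} := HB.pack f (GRing.isLinear.Build _ _ _ _ f flin).
exists K; split.
- have tailN m : exists N, forall n (x : nat -> C),
      \sum_(N <= i < n) cmod (\sum_(0 <= j < n) H i j * x j) ^+ 2 <=
      m.+1%:R^-1 * \sum_(0 <= j < n) cmod (x j) ^+ 2.
    by apply: matrix_tail => //; rewrite invr_gt0.
  have [N HN] := choice tailN.
  apply: precompact_subset (compact_precompact _ (@compact_small_tails R M N)).
    move=> _ [x x1 <-]; have {}x1 : sqnorm x <= 1.
      by move: x1; rewrite /= -[1]/(1%:C%C) ell2_norm_le // expr1n.
    split=> [n|m n].
      by apply: le_trans (kM x n) _; rewrite -[leRHS]mulr1 ler_wpM2l.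
    apply: (@le_trans _ _ (m.+1%:R^-1 * sqnorm x)); first by apply: pass.
    by rewrite -[leRHS]mulr1 ler_wpM2l.
  exact: norm_hausdorff.
- exists (Num.sqrt M) => x; rewrite !ell2_normE -rmorphM lecR -sqrtrM //.
  by apply: ler_wsqrtr; have [] := square_summable_bounded (kM x).
- move=> i j; rewrite /K /=.
  apply: (cvg_parts_unique _ (kP (ell2_basis j) i)).
  split; apply: cvg_near_cst; exists j.+1 => // n /= jn.
    rewrite (bigD1_seq j) ?iota_uniq ?mem_index_iota //= eqxx mulr1 big1 ?addr0 //.
    by move=> l /negPf ->; rewrite mulr0.
  rewrite (bigD1_seq j) ?iota_uniq ?mem_index_iota //= eqxx mulr1 big1 ?addr0 //.
  by move=> l /negPf ->; rewrite mulr0.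
Qed.

End operator.

(** * The Gram matrix of normalized kernels *)

Section gram.
Context {R : realType}.
Notation C := (R[i]).

Lemma near_oneB_neq0 (w z : C) : 1 - w^* * z != 0 ->
  \forall y \near z, 1 - w^* * y != 0.
Proof.
move=> nz; have c : {for z, continuous (fun y : C => 1 - w^* * y)}.
  apply: (@continuousB C C C (cst 1) (fun y : C => w^* * y)).
    exact: (@cst_continuous C C).
  apply: (@continuousM C C (cst w^*) id); last exact: cvg_id.
  exact: (@cst_continuous C C).
exact: (@cvgr_neq0 C C C (nbhs z) _ (fun y : C => 1 - w^* * y) _ c nz).
Qed.

Lemma derivable_derive1n_szego (w z : C) n : 1 - w^* * z != 0 ->
  derivable (derive1n n (szego w)) z 1.
Proof.
move=> nz.
pose D := (fun y => 1 - w^* * y) : C -> C.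
pose F : C -> C := (n`!%:R * w^* ^+ n) *: (fun y => ((D ^+ n.+1) y)^-1).
apply: (@near_eq_derivable _ _ _ F).
  apply: filterS (near_oneB_neq0 nz) => y ny.
  by rewrite derive1n_szego // /F /D exprfctE.
have dD : derivable D z 1.
  have -> : D = cst 1 - (w^* *: id) :> (C -> C) by [].
  by [].
apply: derivableZ; apply: derivableV; last exact: derivableX.
by rewrite exprfctE expf_neq0.
Qed.

Lemma derive1n_nszego (w z : C) n : 1 - w^* * z != 0 ->
  derive1n n (nszego w) z =
  (H2_norm (szego w))%:C%C^-1 * derive1n n (szego w) z.
Proof.
elim: n z => [|n IH] z nz; first by rewrite !derive1n0 /nszego mulrC.
rewrite !derive1nS !derive1E.
pose F : C -> C := (H2_norm (szego w))%:C%C^-1 *: (derive1n n (szego w)).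
rewrite (@near_eq_derive _ _ _ _ F); last first.
  by apply: filterS (near_oneB_neq0 nz) => y ny; rewrite IH.
by rewrite deriveZ //; exact: derivable_derive1n_szego.
Qed.

Lemma H2_norm_szego (w : C) : unit_disc w ->
  H2_norm (szego w) = (szego_weight w)^-1.
Proof.
move=> w1; rewrite /H2_norm H2_dot_szego // /szego /szego_weight -sqrtrV; last first.
  exact/ltW/disc_weight_gt0.
by rewrite mulrC -szego_weight_sqrC // -rmorphXn szego_weight_sqr // -fmorphV.
Qed.

Lemma gramE (alpha : nat -> C) i j : (forall k, unit_disc (alpha k)) ->
  gram alpha i j = nkernel (alpha i) (alpha j).
Proof.
move=> a1; rewrite /gram /H2_dot /dotseq.
have tE (w : C) n : unit_disc w -> taylor (nszego w) n = (szego_weight w)%:C%C * w^* ^+ n.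
  move=> w1; rewrite /taylor derive1n_nszego ?mulr0 ?subr0 ?oner_neq0 //.
  by rewrite H2_norm_szego // fmorphV invrK -mulrA -/(taylor _ _) taylor_szego.
have cz : unit_disc ((alpha j)^* * alpha i).
  by rewrite /unit_disc /= cmodM cmodJ mulr_ilt1 ?cmod_ge0 //; exact: a1.
rewrite [X in series X](_ : _ = fun n =>
    (szego_weight (alpha i) * szego_weight (alpha j))%:C%C * ((alpha j)^* * alpha i) ^+ n).
  apply: (@cvg_lim C) => //.
  rewrite [X in X @ _](_ : _ = fun n => (szego_weight (alpha i) * szego_weight (alpha j))%:C%C *
      series (fun n => ((alpha j)^* * alpha i) ^+ n) n).
    apply: (@cvgM C nat \oo _ (fun=> _)); first exact: cvg_cst.
    exact: cvg_geometricC.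
  by apply/funext => n; rewrite /series /= mulr_sumr.
apply/funext => n; rewrite !tE // [X in _ * X]rmorphM /= conj_real_complex.
rewrite rmorphXn /= conjCK rmorphM exprMn /=; ring.
Qed.

End gram.

(** * Thin sequences *)

Section thin.
Context {R : realType}.
Notation C := (R[i]).

Lemma dotseq_basis (x : nat -> C) i : dotseq x (ell2_basis i) = x i.
Proof.
apply: (@cvg_lim C) => //; apply: cvg_near_cst; exists i.+1 => // n /= ltn.
rewrite /series /= (bigD1_seq i) ?iota_uniq ?mem_index_iota //= eqxx rmorph1 mulr1.
by rewrite big1 ?addr0 // => k /negPf ->; rewrite rmorph0 mulr0.
Qed.

Lemma ell2_basis_norm_le i : `|ell2_basis i : ell2 R| <= 1.
Proof.
rewrite -[1]/(1%:C%C) ell2_norm_le // expr1n.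
have [] // := @square_summable_bounded _ (ell2_basis i : ell2 R) 1.
move=> n; have [le|lt] := leqP n i.
  rewrite big_nat_cond big1 // => k; rewrite andbT => /andP[_ kn] /=.
  by rewrite (ltn_eqF (leq_trans kn le)) cmod0 expr0n.
rewrite (bigD1_seq i) ?iota_uniq ?mem_index_iota //= eqxx cmod1 expr1n.
by rewrite big1 ?addr0 // => k /negPf ->; rewrite cmod0 expr0n.
Qed.

Lemma cmod_le_sqnorm (x : ell2 R) i : cmod (x i) ^+ 2 <= sqnorm x.
Proof.
apply: le_trans (sqnorm_partial_le i i.+1 (ell2P x)).
by rewrite big_nat1.
Qed.

Lemma cmod_le_ell2_norm (x : ell2 R) i : `|x i| <= `|x|.
Proof.
rewrite ell2_normE -cmodE lecR -[leLHS]ger0_norm ?cmod_ge0 // -sqrtr_sqr.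
exact/ler_wsqrtr/cmod_le_sqnorm.
Qed.

(** Otherwise infinitely many terms stay away from 0, and these have a cluster
    point in [A]; its coordinates are 0, so it is 0. *)
Lemma compact_coordwise_cvg0 (A : set (ell2 R)) (y : nat -> ell2 R) :
  compact A -> (forall j, A (y j)) ->
  (forall i, (fun j => cmod (y j i)) @ \oo --> (0 : R)) -> 
  (fun j => sqnorm (y j)) @ \oo --> (0 : R).
Proof.
move=> cA yA y0; apply/cvgrPdist_le => e e0; apply: contrapT => nle.
pose S := [set j | ~ `|0 - sqnorm (y j)| <= e].
have PF : ProperFilter (within S \oo).
  apply: Build_ProperFilter => /= F0; apply: nle.
  have {}F0 : \forall j \near \oo, S j -> False by exact: F0.
  by apply: filterS F0 => j /contrapT.
have FA : (fmap y (within S \oo)) A.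
  by suff : \forall j \near \oo, S j -> A (y j) by []; apply: nearW => j _.
have [p [_ clp]] := cA (fmap y (within S \oo)) _ FA.
have p0 i : p i = 0.
  apply/eqP; rewrite -normr_le0; apply/ler_addgt0Pl => d d0; rewrite addr0.
  have dE : d = (cmod d)%:C%C by rewrite cmodE gtr0_norm.
  have d2 : 0 < cmod d / 2 by rewrite divr_gt0 // -ltcR -dE.
  have small : fmap y (within S \oo) [set x | cmod (x i) <= cmod d / 2].
    suff : \forall j \near \oo, S j -> cmod (y j i) <= cmod d / 2 by [].
    have /cvgrPdist_le /(_ _ d2) := y0 i; apply: filterS => j.
    by rewrite sub0r normrN ger0_norm ?cmod_ge0 // => le _.
  have d2' : 0 < (cmod d / 2)%:C%C :> C by rewrite ltcR.
  have [x [/= xd px]] := clp _ _ small (nbhsx_ballx p _ d2').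
  rewrite -[p i](subrK (x i)) dE [cmod d]splitr rmorphD /=.
  apply: le_trans (ler_normD _ _) _; apply: lerD; last by rewrite -cmodE lecR.
  move: px; rewrite -ball_normE /= => /ltW; apply: le_trans.
  exact: (cmod_le_ell2_norm (p - x) i).
have pE : p = 0 by apply: val_inj; apply/funext => i; exact: p0.
have big : fmap y (within S \oo) [set x | ~ sqnorm x <= e].
  suff : \forall j \near \oo, S j -> ~ sqnorm (y j) <= e by [].
  apply: nearW => j; rewrite /S /= sub0r normrN ger0_norm //.
  exact/sqnorm_ge0/ell2P.
have se0 : 0 < (Num.sqrt e)%:C%C :> C by rewrite ltcR sqrtr_gt0.
have [x [/= nx]] := clp _ _ big (nbhsx_ballx p _ se0).
rewrite pE -ball_normE /= sub0r normrN => /ltW.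
by rewrite ell2_norm_le ?sqrtr_ge0 // sqr_sqrtr // ltW.
Qed.

Section sequence.
Variable alpha : nat -> C.
Hypothesis halpha : blaschke_sequence alpha.

Let a1 j : unit_disc (alpha j). Proof. exact: halpha.1. Qed.

Let gap i j := cmod (nkernel (alpha i) (alpha j)) ^+ 2.

Let gap01 i j : 0 <= gap i j <= 1.
Proof. by rewrite sqr_ge0 /gap nkernel_sqr // gerBl sqr_ge0. Qed.

Let gapC i j : gap i j = gap j i.
Proof. by rewrite /gap -nkernelJ cmodJ. Qed.

Lemma summable_weight : cvgn (series (fun j => szego_weight (alpha j) ^+ 2)).
Proof.
apply: (@series_le_cvg _ _ (2 *: (fun j : nat => 1 - cmod (alpha j)))) => [n|n|n|].
- exact: sqr_ge0.
- by rewrite mulr_ge0 // subr_ge0 ltW //; exact: a1.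
- rewrite szego_weight_sqr // [leRHS](_ : _ = 2 * (1 - cmod (alpha n))) //.
  by have := sqr_ge0 (1 - cmod (alpha n)); lra.
- exact: is_cvg_seriesZ halpha.2.
Qed.

(** Both square-summability of the rows and decay of the entries along a row come
    from this bound. *)
Lemma gap_le i j :
  gap i j <= (1 - cmod (alpha i)) ^- 2 * szego_weight (alpha j) ^+ 2.
Proof.
have ai : 0 < 1 - cmod (alpha i) by rewrite subr_gt0; exact: a1.
have aj := a1 j; have nz := unit_discM_neq0 aj (a1 i).
rewrite /gap cmod_nkernel // expr_div_n exprMn mulrAC ler_wpM2r ?sqr_ge0 //.
rewrite mulrC -[leRHS]mulr1; apply: ler_pM; rewrite ?invr_ge0 ?sqr_ge0 //.
  rewrite lef_pV2 ?posrE ?exprn_gt0 ?cmod_gt0 //.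
  rewrite ler_pXn2r ?nnegrE ?(ltW ai) ?cmod_ge0 // lerBlDr.
  rewrite -[leLHS](@cmod1 R) -[X in cmod X](subrK ((alpha j)^* * alpha i)).
  apply: le_trans (cmodD _ _) _; rewrite lerD2l cmodM cmodJ ler_piMl ?cmod_ge0 //.
  exact: ltW.
by rewrite szego_weight_sqr // gerBl sqr_ge0.
Qed.

Lemma gap_summable i : cvgn (series (gap i)).
Proof.
pose k := (1 - cmod (alpha i)) ^- 2.
apply: (@series_le_cvg _ _ (k *: (fun j : nat => szego_weight (alpha j) ^+ 2))) => [n|n|n|].
- by case/andP: (gap01 i n).
- by rewrite mulr_ge0 ?sqr_ge0 // invr_ge0 sqr_ge0.
- exact: gap_le.
- exact: is_cvg_seriesZ summable_weight.
Qed.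

Let prod_gap j n := \prod_(k < n | k != j :> nat) (1 - gap j k).

Let partial j n := \prod_(k < n | k != j :> nat)
    cmod ((alpha k - alpha j) / (1 - (alpha k)^* * alpha j)).

Lemma partial_sqr j n : partial j n ^+ 2 = prod_gap j n.
Proof.
rewrite /partial -prodrXl; apply: eq_bigr => k _.
rewrite /gap nkernel_sqr // /blaschke_factor.
by rewrite -opprB mulNr cmodN; ring.
Qed.

Lemma partial_ge0 j n : 0 <= partial j n.
Proof. by apply: prodr_ge0 => k _; exact: cmod_ge0. Qed.

Lemma partial_le1 j n : partial j n <= 1.
Proof.
rewrite -(@expr_le1 _ 2) ?partial_ge0 // partial_sqr.
by apply: prodr_ile1 => k _; have := gap01 j k; lra.
Qed.

Lemma partial_nonincreasing j : nonincreasing_seq (partial j).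
Proof.
apply/nonincreasing_seqP => n; rewrite /partial [leLHS]big_mkcond big_ord_recr /=.
rewrite -big_mkcond /= -/(partial j n); case: ifP => _; last by rewrite mulr1.
rewrite ler_piMr ?partial_ge0 // -(@expr_le1 _ 2) ?cmod_ge0 //.
have -> : cmod ((alpha n - alpha j) / (1 - (alpha n)^* * alpha j)) ^+ 2 = 1 - gap j n.
  by rewrite /gap nkernel_sqr // /blaschke_factor !cmodM -opprB cmodN; ring.
by have := gap01 j n; lra.
Qed.

Lemma partial_cvg j : partial j @ \oo --> blaschke_delta alpha j.
Proof.
apply: nonincreasing_is_cvgn; first exact: partial_nonincreasing.
by exists 0 => _ [n _ <-]; exact: partial_ge0.
Qed.

Lemma delta_le_partial j n : blaschke_delta alpha j <= partial j n.
Proof.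
exact: (nonincreasing_cvgn_ge (@partial_nonincreasing j) (@partial_cvg j)).
Qed.

Lemma delta01 j : 0 <= blaschke_delta alpha j <= 1.
Proof.
rewrite (le_trans (delta_le_partial j 0) (partial_le1 j 0)) andbT.
by apply: (cvgr_to_ge (@partial_cvg j)); apply: nearW => n; exact: partial_ge0.
Qed.

Lemma delta_ge (s : R) j : (forall n, \sum_(k < n | k != j :> nat) gap j k <= s) ->
  1 - s <= blaschke_delta alpha j.
Proof.
move=> gap_s; apply: (cvgr_to_ge (@partial_cvg j)); apply: nearW => n.
apply: (@le_trans _ _ (partial j n ^+ 2)); last first.
  by rewrite expr2 ler_piMr ?partial_ge0 ?partial_le1.
rewrite partial_sqr.
apply: le_trans (@weierstrass_prod R _ _ (fun k : 'I_n => gap j k) _) => //.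
by rewrite lerD2l lerN2.
Qed.

(** A product close to 1 controls the sum through [prod (1 - u) <= 1 / (1 + sum u)]. *)
Lemma gap_sum_le (t : R) j n : 0 <= t <= 1 -> 1 - t / 4 <= blaschke_delta alpha j ->
  \sum_(k < n | k != j :> nat) gap j k <= t.
Proof.
move=> /andP[t0 t1] dt.
have := @prod_sum_le1 R _ (fun k : 'I_n => k != j :> nat) (fun k : 'I_n => gap j k) _.
move=> /(_ (fun k => gap01 j k)); rewrite -/(prod_gap j n) -partial_sqr.
have S0 : 0 <= \sum_(k < n | k != j :> nat) gap j k.
  by apply: sumr_ge0 => k _; case/andP: (gap01 j k).
have : 1 - t / 2 <= partial j n ^+ 2.
  apply: (@le_trans _ _ ((1 - t / 4) ^+ 2)); first by have := sqr_ge0 t; lra.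
  rewrite ler_pXn2r ?nnegrE ?partial_ge0 //; last by lra.
  exact: le_trans dt (delta_le_partial _ _).
move: (partial j n ^+ 2) S0 => P.
move: (\sum_(k < n | _) _) => S S0 PE PS.
have : (1 - t / 2) * (1 + S) <= 1.
  by apply: le_trans PS; apply: ler_wpM2r => //; lra.
have : 0 <= (1 - t) * S by rewrite mulr_ge0 // subr_ge0.
lra.
Qed.

Let H i j : C := nkernel (alpha i) (alpha j) - (i == j)%:R.

Let H_conj i j : (H i j)^* = H j i.
Proof. by rewrite /H rmorphB /= rmorph_nat nkernelJ eq_sym. Qed.

Let H_le i j : cmod (H i j) ^+ 2 <= gap i j.
Proof.
rewrite /H /gap; case: eqVneq => [->|_]; last by rewrite subr0.
by rewrite nkernel_id // subrr cmod0 expr0n sqr_ge0.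
Qed.

Let H_neq i j : i != j -> cmod (H i j) ^+ 2 = gap i j.
Proof. by move=> ij; rewrite /H (negPf ij) subr0. Qed.

Lemma identity_plus_compact_thin :
  identity_plus_compact (gram alpha) -> thin alpha.
Proof.
move=> [T [K [_ TG Kc TK]]].
have KH i j : K (ell2_basis j) i = H i j.
  have := TG i j; rewrite dotseq_basis TK gramE // /H => <-.
  have -> : (ell2_basis j + K (ell2_basis j)) i = (i == j)%:R + K (ell2_basis j) i by [].
  by rewrite addrC addKr.
have K0 : (fun j => sqnorm (K (ell2_basis j))) @ \oo --> (0 : R).
  apply: (@compact_coordwise_cvg0 (closure (K @` [set x | `|x| <= 1]))).
  - by rewrite -precompactE.
  - by move=> j; apply: subset_closure; exists (ell2_basis j) => //; exact: ell2_basis_norm_le.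
  move=> i; under eq_fun do rewrite KH.
  have sq : (fun j => cmod (H i j) ^+ 2) @ \oo --> (0 : R).
    apply: (@squeeze_cvgr _ _ _ _ (fun=> 0) (gap i)).
    - by apply: nearW => j; rewrite sqr_ge0 H_le.
    - exact: cvg_cst.
    - exact: cvg_series_cvg_0 (@gap_summable i).
  apply/cvgrPdist_le => e e0.
  have e2 : 0 < e ^+ 2 by rewrite exprn_gt0.
  have /cvgrPdist_le /(_ _ e2) := sq; apply: filterS => j.
  rewrite !sub0r !normrN !ger0_norm ?sqr_ge0 ?cmod_ge0 //.
  by rewrite ler_pXn2r ?nnegrE ?cmod_ge0 // ltW.
rewrite /thin; apply: (@squeeze_cvgr _ _ _ _ (fun j => 1 - sqnorm (K (ell2_basis j))) (fun=> 1)).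
- apply: nearW => j; have /andP[_ ->] := delta01 j; rewrite andbT.
  apply: delta_ge => n; apply: (@le_trans _ _ (\sum_(0 <= k < n) cmod (K (ell2_basis j) k) ^+ 2)).
    rewrite big_mkord big_mkcond /=; apply: ler_sum => k _.
    by case: ifPn => kj; rewrite ?sqr_ge0 // KH H_neq // gapC.
  exact/sqnorm_partial_le/ell2P.
- by rewrite -[X in _ --> X]subr0; apply: cvgB => //; exact: cvg_cst.
- exact: cvg_cst.
Qed.

(** The points after the index [N] satisfy the hypotheses of
    [gram_form_near_identity]: thinness gives the separation, the Blaschke
    condition the smallness of the weights. *)
Lemma thin_tail_small (e : R) : thin alpha -> 0 < e -> exists N, forall n (x : nat -> C),
    \sum_(N <= i < n) cmod (\sum_(N <= j < n) H i j * x j) ^+ 2 <=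
    e * \sum_(N <= j < n) cmod (x j) ^+ 2.
Proof.
move=> thin_a e0.
(* The form is within [16 mu] of the identity, so its square must not exceed [e]. *)
pose mu := Num.min (1 / 2) (Num.sqrt e / 16).
have mu0 : 0 < mu by rewrite lt_min !divr_gt0 // sqrtr_gt0.
have mu_half : mu <= 1 / 2 by rewrite ge_min lexx.
have mu1 : mu < 1 by lra.
have mue : (16 * mu) ^+ 2 <= e.
  have le : mu <= Num.sqrt e / 16 by rewrite ge_min lexx orbT.
  rewrite -[leRHS]sqr_sqrtr ?(ltW e0) // ler_pXn2r ?nnegrE ?sqrtr_ge0 //; last first.
    by rewrite mulr_ge0 // ltW.
  by move: le; lra.
have mu4 : 0 < mu ^+ 4 by rewrite exprn_gt0.
have mu4' : 0 < mu ^+ 4 / 4 by rewrite divr_gt0.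
have [N1 HN1] := cvg_tail_small (fun=> sqr_ge0 _) summable_weight mu4.
have [N2 _ HN2] : \forall j \near \oo, 1 - mu ^+ 4 / 4 <= blaschke_delta alpha j.
  have /cvgrPdist_le /(_ _ mu4') := thin_a; apply: filterS => j.
  by rewrite ler_norml => /andP[_]; lra.
pose N := maxn N1 N2; exists N => n x.
pose a i := alpha (i + N); pose m := (n - N)%N.
have sep (i : 'I_m) : \sum_(j < m | j != i) cmod (nkernel (a i) (a j)) ^+ 2 <= mu ^+ 4.
  apply: le_trans (@gap_sum_le (mu ^+ 4) (i + N) n _ _).
  - rewrite -(big_mkord (fun k => k != i + N)%N (gap (i + N))).
    rewrite -(big_mkord (fun j => j != i :> nat) (fun j => gap (i + N) (j + N))).
    rewrite [leRHS]big_mkcond [leLHS]big_mkcond /=.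
    rewrite [leLHS](_ : _ = \sum_(N <= k < n) if (k != i + N)%N then gap (i + N) k else 0).
      apply: (@le_big_nat _ (fun k => if (k != i + N)%N then gap (i + N) k else 0)) => // k.
      by case: ifP => // _; case/andP: (gap01 (i + N) k).
    by rewrite (big_addn 0 n N); apply: eq_bigr => k _; rewrite eqn_add2r.
  - by rewrite ltW //= exprn_ile1 // ltW.
  - by apply: HN2 => /=; rewrite (leq_trans (leq_maxr N1 N2)) ?leq_addl.
have small : \sum_(i < m) szego_weight (a i) ^+ 2 <= mu ^+ 4.
  rewrite -(big_mkord xpredT (fun i => szego_weight (alpha (i + N)) ^+ 2)).
  rewrite -(big_addn 0 n N xpredT (fun i => szego_weight (alpha i) ^+ 2)).
  apply: le_trans (HN1 n); apply: (@le_big_nat _ (fun i => szego_weight (alpha i) ^+ 2)) => //.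
    by move=> i; exact: sqr_ge0.
  exact: leq_maxl.
have aN i : unit_disc (a i) by exact: a1.
have near_id := gram_form_near_identity aN mu0 mu1 sep small.
have := @hermitian_norm_bound R m (fun i j => H (i + N) (j + N)) (16 * mu) _ _ _
  (fun i => x (i + N)).
rewrite mulr_gt0 // => /(_ isT (fun i j => H_conj _ _)) bound.
rewrite !(big_addn 0 n N) !big_mkord -/m.
under eq_bigr => i _ do rewrite (big_addn 0 n N) big_mkord -/m.
apply: le_trans (bound _) _; last first.
  by apply: ler_wpM2r => //; apply: sumr_ge0 => i _; exact: sqr_ge0.
move=> c; move: (near_id c); congr (`|_| <= _).
have -> : \sum_(i < m) cmod (c i) ^+ 2 =
    complex.Re (\sum_(i < m) \sum_(j < m) c i * (c j)^* * (i + N == j + N)%N%:R).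
  rewrite Re_sum; apply: eq_bigr => i _.
  rewrite (bigD1 i) //= eqxx mulr1 big1 ?addr0 -?cmod_sqrC // => j ji.
  by rewrite eqn_add2r val_eqE eq_sym (negPf ji) mulr0.
rewrite -ReN -ReD /gram_form -sumrB; congr (complex.Re _); apply: eq_bigr => i _.
by rewrite -sumrB; apply: eq_bigr => j _; rewrite -mulrBr.
Qed.

Lemma thin_identity_plus_compact :
  thin alpha -> identity_plus_compact (gram alpha).
Proof.
move=> thin_a.
have Hrow i : square_summable (H i).
  apply: (@series_le_cvg _ _ (gap i)) => [n|n|n|]; rewrite ?sqr_ge0 ?H_le //.
  exact: gap_summable.
have Hcol j : square_summable (H^~ j).
  rewrite /square_summable (_ : (fun n => _) = (fun n => cmod (H j n) ^+ 2)) //; first exact: Hrow.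
  by apply/funext => n; rewrite -H_conj cmodJ.
have [K [Kc [M KM] KH]] := compact_matrix_operator Hrow Hcol (fun e => thin_tail_small thin_a).
pose f (x : ell2 R) := x + K x.
have flin : linear f.
  by move=> z x y; rewrite /f linearP scalerDr addrACA.
pose T : {linear ell2 R -> ell2 R} := HB.pack f (GRing.isLinear.Build _ _ _ _ f flin).
exists T, K; split => //.
- exists (1 + M) => x; rewrite rmorphD rmorph1 mulrDl mul1r.
  by apply: le_trans (ler_normD _ _) _; rewrite lerD2l.
- move=> i j; rewrite dotseq_basis gramE //.
  have -> : T (ell2_basis j) i = (i == j)%:R + K (ell2_basis j) i by [].
  by rewrite KH /H addrC subrK.
Qed.

End sequence.
End thin.

Theorem theorem3p5 (R : realType) (alpha : nat -> R[i])
    (halpha : blaschke_sequence alpha) :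
  thin alpha <-> identity_plus_compact (gram alpha).
Proof.
split; first exact: thin_identity_plus_compact.
exact: identity_plus_compact_thin.
Qed.
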